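(* Let $\alpha\ge 1$ and let $F_t\in\mathbb A_t^{[\alpha]}\langle\langle z\rangle\rangle$ with D-Log $a_t(z)$ and associated differential operators $\lambda_m,s_m,\psi_m,\xi_m$ ($m\ge1$). Then $$a_t(z)=\sum_{I\in\mathcal C}\frac{(-1)^{\ell(I)-|I|+1}}{\ell(I)}\,t^{|I|}\,\lambda^I z,$$ $$a_t(z)=\sum_{I\in\mathcal C}\frac{(-1)^{\ell(I)}}{\ell(I)}\,t^{|I|}\,s^I z,$$ $$a_t(z)=\sum_{I\in\mathcal C}\Big(\sum_{J:\,I\succeq J}\frac{(-1)^{\ell(J)}}{\pi_u(I,J)\,\ell(J)}\Big)t^{|I|}\,\psi^I z,$$ $$a_t(z)=\sum_{I\in\mathcal C}\Big(\sum_{J:\,I\succeq J}\frac{(-1)^{\ell(J)}}{\pi_u(\bar I,\bar J)\,\ell(J)}\Big)t^{|I|}\,\xi^I z.$$ In the inner sums $J$ ranges over all compositions such that $I$ is a refinement of $J$.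
   Context: $K$ is a unital commutative $\mathbb Q$-algebra, $z=(z_1,\dots,z_n)$ are commutative or noncommutative free variables, and $t$ is a formal parameter commuting with $z$ and $K$. $K\langle\langle z\rangle\rangle$ and $K[[t]]\langle\langle z\rangle\rangle$ are the formal power series algebras in $z$ over $K$ and $K[[t]]$ (in either the commutative or the noncommutative case); $o(\cdot)$ is the order in $z$. For a vector $\vec u=(u_1,\dots,u_n)$ of power series, $[\vec u\frac{\partial}{\partial z}]$ is the derivation sending $z_i$ to $u_i$. Operators are applied to vectors componentwise, so for an operator $P$, $Pz=(Pz_1,\dots,Pz_n)$. For $\alpha\ge1$, $\mathbb A_t^{[\alpha]}\langle\langle z\rangle\rangle$ is the set of automorphisms $F_t(z)=z-H_t(z)$ of $K[[t]]\langle\langle z\rangle\rangle$ over $K[[t]]$ with $o(H_t(z))\ge\alpha$ and $H_{t=0}(z)=0$. For such $F_t$ write the inverse map as $G_t(z)=F_t^{-1}(z)=z+M_t(z)$. Let $\mathcal D^{[\alpha]}\langle\langle z\rangle\rangle$ be the unital algebra generated by $K$-derivations of $K\langle\langle z\rangle\rangle$ that increase the degree in $z$ by at least $\alpha-1$. There are unique $f(t),g(t),d(t)\in\mathcal D^{[\alpha]}\langle\langle z\rangle\rangle[[t]]$ with $f(0)=1$, $d(0)=0$ such that for all $u_t(z)\in K[[t]]\langle\langle z\rangle\rangle$: $f(-t)u_t(z)=u_t(F_t)$, $g(t)u_t(z)=u_t(G_t)$, $e^{d(t)}u_t(z)=u_t(G_t)$. Put also $h(t)=[\frac{\partial M_t}{\partial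 t}(F_t)\frac{\partial}{\partial z}]$ and $m(t)=[\frac{\partial H_t}{\partial t}(G_t)\frac{\partial}{\partial z}]$. Define differential operators $\lambda_m,s_m,\phi_m,\psi_m,\xi_m$ by $$f(t)=\sum_{m\ge0}t^m\lambda_m,\quad g(t)=\sum_{m\ge0}t^ms_m,\quad d(t)=\sum_{m\ge1}\tfrac{t^m}{m}\phi_m,\quad h(t)=\sum_{m\ge1}t^{m-1}\psi_m,\quad m(t)=\sum_{m\ge1}t^{m-1}\xi_m.$$ The D-Log $a_t(z)\in tK[[t]]\langle\langle z\rangle\rangle^{\times n}$ of $F_t$ is defined by $d(t)=-[a_t(z)\frac{\partial}{\partial z}]$. A composition is a nonempty finite sequence $I=(i_1,\dots,i_m)$ of positive integers; $\ell(I)=m$, $|I|=i_1+\cdots+i_m$, $\bar I=(i_m,\dots,i_1)$, $\mathcal C$ is the set of all compositions. For a sequence $w=\{w_k\}$, $w^I=w_{i_1}\cdots w_{i_m}$. $\pi_u(I)=\prod_{j=1}^m(i_1+\cdots+i_j)$. $J\succeq I$ means $J$ is a refinement of $I$: $J$ is the concatenation $J_1\cdot J_2\cdots J_m$ of compositions $J_a$ with $|J_a|=i_a$; then $\pi_u(J,I)=\prod_{a=1}^m\pi_u(J_a)$. *)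

(* Defs.v *)
From HB Require Import structures.
From mathcomp Require Import all_boot all_order all_algebra.
From mathcomp Require Import boolp.

Set Implicit Arguments.
Unset Strict Implicit.
Unset Printing Implicit Defensive.

Import GRing.Theory.

Local Open Scope ring_scope.

(* Monoids in which every element has finitely many factorizations. *)
HB.mixin Record isFactMonoid M of Choice M := {
  mon1 : M;
  monM : M -> M -> M;
  monMA : associative monM;
  mon1M : left_id mon1 monM;
  monM1 : right_id mon1 monM;
  splits : M -> seq (M * M);
  splits_uniq : forall m, uniq (splits m);
  mem_splits : forall m p, (p \in splits m) = (monM p.1 p.2 == m)
}.

#[short(type="factMonoidType")]
HB.structure Definition FactMonoid := {M of isFactMonoid M & Choice M}.

Arguments mon1 {s}.

(* [series M R] is the set of formal sums of u m . m over m in M. *)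
Definition series (M : factMonoidType) (R : nzRingType) : Type := M -> R.

Section Series.
Variables (M : factMonoidType) (R : nzRingType).
Implicit Types u v w : series M R.

HB.instance Definition _ := gen_eqMixin (series M R).
HB.instance Definition _ := gen_choiceMixin (series M R).

Definition series0 : series M R := fun=> 0.
Definition series_opp u : series M R := fun m => - u m.
Definition series_add u v : series M R := fun m => u m + v m.

Fact series_addA : associative series_add.
Proof. by move=> u v w; apply/funext => m; apply: addrA. Qed.
Fact series_addC : commutative series_add.
Proof. by move=> u v; apply/funext => m; apply: addrC. Qed.
Fact series_add0 : left_id series0 series_add.
Proof. by move=> u; apply/funext => m; apply: add0r. Qed.
Fact series_addN : left_inverse series0 series_opp series_add.
Proof. by move=> u; apply/funext => m; apply: addNr. Qed.

HB.instance Definition _ := GRing.isZmodule.Build (series M R)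
  series_addA series_addC series_add0 series_addN.

Definition series1 : series M R := fun m => (m == mon1)%:R.
Definition series_mul u v : series M R :=
  fun m => \sum_(p <- splits m) u p.1 * v p.2.

Fact series_mulA : associative series_mul.
Proof.
move=> u v w; apply/funext => m; rewrite /series_mul.
under eq_bigr do rewrite mulr_sumr.
under [RHS]eq_bigr do rewrite mulr_suml.
pose l (p : M * M) := [seq (p.1, q.1, q.2) | q <- splits p.2].
pose r (p : M * M) := [seq (q.1, q.2, p.2) | q <- splits p.1].
transitivity (\sum_(x <- flatten [seq l p | p <- splits m])
                u x.1.1 * (v x.1.2 * w x.2)).
  by rewrite big_flatten big_map; apply: eq_bigr => p _; rewrite big_map.
transitivity (\sum_(x <- flatten [seq r p | p <- splits m])
                u x.1.1 * (v x.1.2 * w x.2)); last first.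
  rewrite big_flatten big_map; apply: eq_bigr => p _; rewrite big_map.
  by apply: eq_bigr => q _; rewrite mulrA.
apply: perm_big; apply: uniq_perm.
- apply: allpairs_uniq_dep => [|p _|]; rewrite ?splits_uniq //.
  move=> [[a b] [c d]] [[a' b'] [c' d']] /allpairsPdep[p [q [_ + ->]]].
  move=> /[swap] /allpairsPdep[p' [q' [_ + ->]]] /=.
  rewrite !mem_splits => /eqP e' /eqP e [e1 e2 e3].
  case: p p' q q' e1 e e' e2 e3 => [? ?] [? ?] [? ?] [? ?] /= -> <- <-.
  by move=> -> ->.
- apply: allpairs_uniq_dep => [|p _|]; rewrite ?splits_uniq //.
  move=> [[a b] [c d]] [[a' b'] [c' d']] /allpairsPdep[p [q [_ + ->]]].
  move=> /[swap] /allpairsPdep[p' [q' [_ + ->]]] /=.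
  rewrite !mem_splits => /eqP e' /eqP e [e1 e2 e3].
  case: p p' q q' e3 e e' e1 e2 => [? ?] [? ?] [? ?] [? ?] /= -> <- <-.
  by move=> -> ->.
- move=> [[a b] c]; apply/allpairsPdep/allpairsPdep => /=.
  + move=> [[x y] [[z t]]] /=; rewrite !mem_splits /=.
    move=> [/eqP <- /eqP <- [-> -> ->]]; exists (monM x z, t), (x, z).
    by rewrite !mem_splits /= monMA !eqxx.
  + move=> [[x y] [[z t]]] /=; rewrite !mem_splits /=.
    move=> [/eqP <- /eqP <- [-> -> ->]]; exists (z, monM t y), (t, y).
    by rewrite !mem_splits /= monMA !eqxx.
Qed.

Fact series_mul1 : left_id series1 series_mul.
Proof.
move=> u; apply/funext => m; rewrite /series_mul /series1.
rewrite (bigD1_seq (mon1, m)) ?splits_uniq ?mem_splits ?mon1M //=.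
rewrite eqxx mul1r big_seq_cond big1 ?addr0 // => -[a b] /=.
rewrite mem_splits /= => /andP[/eqP <-]; case: (eqVneq a mon1) => [->|]; last first.
  by rewrite mul0r.
by rewrite mon1M eqxx.
Qed.

Fact series_mulr1 : right_id series1 series_mul.
Proof.
move=> u; apply/funext => m; rewrite /series_mul /series1.
rewrite (bigD1_seq (m, mon1)) ?splits_uniq ?mem_splits ?monM1 //=.
rewrite eqxx mulr1 big_seq_cond big1 ?addr0 // => -[a b] /=.
rewrite mem_splits /= => /andP[/eqP <-]; case: (eqVneq b mon1) => [->|]; last first.
  by rewrite mulr0.
by rewrite monM1 eqxx.
Qed.

Fact series_mulDl : left_distributive series_mul +%R.
Proof.
move=> u v w; apply/funext => m; rewrite /series_mul.
by rewrite -[RHS]big_split; apply: eq_bigr => p _; apply: mulrDl.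
Qed.

Fact series_mulDr : right_distributive series_mul +%R.
Proof.
move=> u v w; apply/funext => m; rewrite /series_mul.
by rewrite -[RHS]big_split; apply: eq_bigr => p _; apply: mulrDr.
Qed.

Fact series1_neq0 : series1 != 0.
Proof.
apply/eqP => /(congr1 (@^~ mon1)) /eqP.
by rewrite /series1 eqxx oner_eq0.
Qed.

HB.instance Definition _ := GRing.Zmodule_isNzRing.Build (series M R)
  series_mulA series_mul1 series_mulr1 series_mulDl series_mulDr series1_neq0.

Definition series_scale (a : R) u : series M R := fun m => a * u m.

Fact series_scaleA a b u :
  series_scale a (series_scale b u) = series_scale (a * b) u.
Proof. by apply/funext => m; apply: mulrA. Qed.
Fact series_scale1 : left_id 1 series_scale.
Proof. by move=> u; apply/funext => m; apply: mul1r. Qed.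
Fact series_scaleDr : right_distributive series_scale +%R.
Proof. by move=> a u v; apply/funext => m; apply: mulrDr. Qed.
Fact series_scaleDl u : {morph series_scale^~ u : a b / a + b}.
Proof. by move=> a b; apply/funext => m; apply: mulrDl. Qed.

HB.instance Definition _ := GRing.Zmodule_isLmodule.Build R (series M R)
  series_scaleA series_scale1 series_scaleDr series_scaleDl.

Fact series_scaleAl (a : R) u v : a *: (u * v) = (a *: u) * v.
Proof.
apply/funext => m.
transitivity (a * \sum_(p <- splits m) u p.1 * v p.2) => //.
by rewrite mulr_sumr; apply: eq_bigr => p _; apply: mulrA.
Qed.

HB.instance Definition _ :=
  GRing.Lmodule_isLalgebra.Build R (series M R) series_scaleAl.

End Series.

(* k : nat stands for the monomial t^k. *)
Definition nat_splits (k : nat) := [seq (i, (k - i)%N) | i <- iota 0 k.+1].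

Fact nat_splits_uniq k : uniq (nat_splits k).
Proof. by rewrite map_inj_uniq ?iota_uniq // => i j []. Qed.

Fact mem_nat_splits k p : (p \in nat_splits k) = ((p.1 + p.2)%N == k).
Proof.
apply/mapP/eqP => [[i + ->] /=|<-].
  by rewrite mem_iota add0n ltnS => /= /subnKC.
exists p.1; last by rewrite addKn -surjective_pairing.
by rewrite mem_iota add0n ltnS leq_addr.
Qed.

HB.instance Definition _ := isFactMonoid.Build nat
  addnA add0n addn0 nat_splits_uniq mem_nat_splits.

Variant kind := Commutative | Noncommutative.

(* A monomial in z_1, .., z_n is represented by the word of its letters, which
   is required to be nondecreasing when the variables commute. *)
Section Monomials.
Variables (c : kind) (n : nat).

Definition ordle : rel 'I_n := relpre val leq.

Definition normal (w : seq 'I_n) : bool :=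
  if c is Commutative then sorted ordle w else true.

Definition normalize (w : seq 'I_n) : seq 'I_n :=
  if c is Commutative then sort ordle w else w.

Record mon := Mon { word :> seq 'I_n; _ : normal word }.

HB.instance Definition _ := [isSub for word].
HB.instance Definition _ := [Choice of mon by <:].

Definition mdeg (m : mon) : nat := size m.

Fact ordle_total : total ordle. Proof. by move=> i j; apply: leq_total. Qed.
Fact ordle_trans : transitive ordle.
Proof. by move=> j i k; apply: leq_trans. Qed.
Fact ordle_anti : antisymmetric ordle.
Proof. by move=> i j /anti_leq /val_inj. Qed.

Fact normalizeP w : normal (normalize w).
Proof.
by rewrite /normal /normalize; case: c => //; apply: sort_sorted ordle_total _.
Qed.

Fact normalize_id w : normal w -> normalize w = w.
Proof.
by rewrite /normal /normalize; case: c => //; apply: sorted_sort ordle_trans _.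
Qed.

Fact size_normalize w : size (normalize w) = size w.
Proof. by rewrite /normalize; case: c; rewrite ?size_sort. Qed.

Fact normalize_catl v w : normalize (normalize v ++ w) = normalize (v ++ w).
Proof.
rewrite /normalize; case: c => //.
by apply/(perm_sortP ordle_total ordle_trans ordle_anti); rewrite perm_cat2r perm_sort.
Qed.

Fact normalize_catr v w : normalize (v ++ normalize w) = normalize (v ++ w).
Proof.
rewrite /normalize; case: c => //.
by apply/(perm_sortP ordle_total ordle_trans ordle_anti); rewrite perm_cat2l perm_sort.
Qed.

Fact normal_nil : normal [::]. Proof. by rewrite /normal; case: c. Qed.
Fact normal_letter i : normal [:: i]. Proof. by rewrite /normal; case: c. Qed.

Definition mword (w : seq 'I_n) : mon := Mon (normalizeP w).
Definition mnil : mon := Mon normal_nil.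
Definition mvar (i : 'I_n) : mon := Mon (normal_letter i).
Definition mmul (a b : mon) : mon := mword (word a ++ word b).

Fact mmulA : associative mmul.
Proof.
by move=> a b d; apply: val_inj; rewrite /= normalize_catl normalize_catr catA.
Qed.

Fact mmul1 : left_id mnil mmul.
Proof. by move=> [w nw]; apply: val_inj; rewrite /= normalize_id. Qed.

Fact mmulr1 : right_id mnil mmul.
Proof. by move=> [w nw]; apply: val_inj; rewrite /= cats0 normalize_id. Qed.

(* The monomials of degree at most d. *)
Definition mons (d : nat) : seq mon :=
  pmap insub [seq val w | w <- enum {: d.-bseq 'I_n}].

Fact mons_uniq d : uniq (mons d).
Proof.
apply: (pmap_uniq (insubK _)).
by rewrite map_inj_uniq ?enum_uniq //; apply: val_inj.
Qed.

Fact mem_mons d m : (m \in mons d) = (mdeg m <= d)%N.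
Proof.
rewrite mem_pmap_sub; apply/mapP/idP => [[w _ e]|le_md].
  by rewrite /mdeg -[word m]/(val m) e size_bseq.
by exists (Bseq le_md); rewrite ?mem_enum.
Qed.

Definition mon_splits (m : mon) : seq (mon * mon) :=
  [seq p <- [seq (a, b) | a <- mons (mdeg m), b <- mons (mdeg m)]
     | mmul p.1 p.2 == m].

Fact mon_splits_uniq m : uniq (mon_splits m).
Proof.
by rewrite filter_uniq // allpairs_uniq ?mons_uniq // => -[? ?] [? ?] _ _ [-> ->].
Qed.

Fact mem_mon_splits m p : (p \in mon_splits m) = (mmul p.1 p.2 == m).
Proof.
rewrite mem_filter; case: eqVneq => //= <-; case: p => a b /=.
apply/allpairsP; exists (a, b).
by rewrite !mem_mons /mdeg /= size_normalize size_cat leq_addr leq_addl.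
Qed.

HB.instance Definition _ := isFactMonoid.Build mon
  mmulA mmul1 mmulr1 mon_splits_uniq mem_mon_splits.

End Monomials.

(* [tser R] is R[[t]] and [zser c n R] is R<<z>>, so that
   [zser c n (tser K)] is K[[t]]<<z>>. *)
Notation tser R := (series nat R).
Notation zser c n R := (series (mon c n) R).

Section ZSeries.
Variables (c : kind) (n : nat) (R : nzRingType).
Implicit Types u : zser c n R.

Definition z (i : 'I_n) : zser c n R := fun m => (m == mvar c i)%:R.

Definition order_ge (k : nat) u : Prop := forall m, (mdeg m < k)%N -> u m = 0.

(* u(F) for o(F_i) >= 1. The monomial m then only occurs in F_(w_1) .. F_(w_d)
   for words w of length d <= deg m, so that the sum below is the whole
   coefficient of m. *)
Definition subst (F : 'I_n -> zser c n R) u : zser c n R :=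
  fun m => \sum_(w <- mons c n (mdeg m)) u w * (\prod_(i <- word w) F i) m.

(* The sum of z_(w_1) .. z_(w_(j-1)) v_(w_j) z_(w_(j+1)) .. z_(w_d) over j. *)
Fixpoint word_der (v : 'I_n -> zser c n R) (w : seq 'I_n) : zser c n R :=
  if w is i :: w' then v i * \prod_(j <- w') z j + z i * word_der v w' else 0.

(* The derivation [v d/dz]. It lowers degrees by at most 1, hence the bound on
   the degree of w. *)
Definition der (v : 'I_n -> zser c n R) u : zser c n R :=
  fun m => \sum_(w <- mons c n (mdeg m).+1) u w * word_der v (word w) m.

Definition is_derivation (D : zser c n R -> zser c n R) : Prop :=
  linear D /\ forall u v, D (u * v) = D u * v + u * D v.

(* The algebra D^[alpha]<<z>>; [k + alpha.-1] is k + (alpha - 1) as alpha >= 1. *)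
Inductive Dalg (alpha : nat) : (zser c n R -> zser c n R) -> Prop :=
| Dalg_der D of is_derivation D
    & (forall k u, order_ge k u -> order_ge (k + alpha.-1)%N (D u)) : Dalg alpha D
| Dalg_1 : Dalg alpha id
| Dalg_add P Q of Dalg alpha P & Dalg alpha Q : Dalg alpha (fun u => P u + Q u)
| Dalg_scale a P of Dalg alpha P : Dalg alpha (fun u => a *: P u)
| Dalg_comp P Q of Dalg alpha P & Dalg alpha Q : Dalg alpha (P \o Q).

End ZSeries.

Arguments z {c n R} i.

(* u(F) is invertible as an operation on u; F is thus identified with the
   endomorphism z_i |-> F_i. *)
Definition is_automorphism (c : kind) (n : nat) (R : nzRingType)
    (F : 'I_n -> zser c n R) : Prop :=
  (forall i, order_ge 1 (F i)) /\ bijective (subst F).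

Section TSeries.
Variables (c : kind) (n : nat) (K : comAlgType rat).
Let A := zser c n K.
Let At := zser c n (tser K).

Definition tcoef (k : nat) (u : At) : A := fun m => u m k.

(* The sum of t^k p_k over k. *)
Definition tsum (p : nat -> A) : At := fun m k => p k m.

Definition dt (u : At) : At := fun m k => (u m k.+1) *+ k.+1.

(* The action on K[[t]]<<z>> of P(t), the sum of t^k P_k over k, where each P_k
   is an operator on K<<z>>. *)
Definition act (P : nat -> A -> A) (u : At) : At :=
  tsum (fun k => \sum_(i < k.+1) P i (tcoef (k - i) u)).

(* The action of e^P(t) for P(0) = 0: the terms P(t)^j / j! with j > k do not
   contribute to the coefficient of t^k. *)
Definition act_exp (P : nat -> A -> A) (u : At) : At :=
  tsum (fun k => \sum_(j < k.+1)
                   (j`!%:R^-1)%:A *: tcoef k (iter j (act P) u)).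

(* The compositions of k. The empty sequence, of weight 0, is not one. *)
Fixpoint compositions (k : nat) : seq (seq nat) :=
  match k with
  | 0 => [::]
  | 1 => [:: [:: 1%N]]
  | k'.+1 => [seq 1%N :: J | J <- compositions k'] ++
             [seq (head 0%N J).+1 :: behead J | J <- compositions k']
  end.

(* The sum of t^|I| p(I) over all compositions I. *)
Definition csum (p : seq nat -> A) : At :=
  tsum (fun k => \sum_(J <- compositions k) p J).

Definition opow (w : nat -> A -> A) (I : seq nat) : A -> A :=
  \big[comp/id]_(i <- I) w i.

End TSeries.

Lemma mem_compositions k I :
  (I \in compositions k) = [&& I != [::], all (leq 1) I & sumn I == k].
Proof.
elim: k I => [|[|k] IHk] I.
- by case: I => [|[|i] I] //=; rewrite andbF.
- by rewrite inE; case: I => [|[|[|i]] [|[|j] I]] //=; rewrite andbF.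
rewrite [compositions _.+2]/([seq 1%N :: J | J <- compositions k.+1] ++
  [seq (head 0%N J).+1 :: behead J | J <- compositions k.+1]) mem_cat.
case: I => [|[|i] I] /=.
- by apply/negbTE/norP; split; apply/mapP => -[].
- by apply/negbTE/norP; split; apply/mapP => -[].
case: i => [|i].
  rewrite mem_map => [|? ? []//]; rewrite IHk add1n eqSS.
  rewrite orbC; case: mapP => [[[|[|j] J]]|_]; rewrite ?IHk //=.
  by case: I.
have -> : (i.+2 :: I \in [seq 1%N :: J | J <- compositions k.+1]) = false.
  by apply/negbTE/mapP => -[].
rewrite -[RHS](IHk (i.+1 :: I)); apply/mapP/idP => [[[|j J]]|Ik].
- by rewrite IHk.
- by move=> /[swap] -[-> ->].
- by exists (i.+1 :: I).
Qed.

Lemma compositions_uniq k : uniq (compositions k).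
Proof.
elim: k => [|[|k] IHk] //.
rewrite [compositions _.+2]/([seq 1%N :: J | J <- compositions k.+1] ++
  [seq (head 0%N J).+1 :: behead J | J <- compositions k.+1]).
rewrite cat_uniq map_inj_uniq ?IHk ?andTb => [|? ? []//]; apply/andP; split.
  apply/hasPn => _ /mapP[I + ->]; rewrite mem_compositions.
  by case: I => [|[|i] I] //= _; apply/mapP => -[].
rewrite map_inj_in_uniq // => I J; rewrite !mem_compositions.
by case: I J => [|i I] [|j J] //= _ _ [-> ->].
Qed.

(* All ways to write I as a concatenation of nonempty sequences. *)
Definition splittings (I : seq nat) : seq (seq (seq nat)) :=
  [seq reshape s I | s <- compositions (size I)].

(* I is a refinement of J: I = I_1 .. I_m with |I_a| = j_a. *)
Definition refines (I J : seq nat) : bool :=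
  J \in [seq map sumn B | B <- splittings I].

Lemma refinesP I J : I != [::] ->
  reflect (exists B : seq (seq nat),
             [/\ all (fun b => b != [::]) B, flatten B = I & map sumn B = J])
          (refines I J).
Proof.
move=> I0; apply: (iffP mapP) => [[_ /mapP[s + ->] ->]|[B [Bn BI <-]]].
  rewrite mem_compositions => /and3P[_ s1 /eqP es].
  exists (reshape s I); split=> //; last by rewrite reshapeKr ?es.
  have: all (leq 1) (shape (reshape s I)) by rewrite reshapeKl ?es.
  by rewrite all_map; apply: sub_all => b /=; rewrite -size_eq0 lt0n.
exists B => //; apply/mapP; exists (shape B); last by rewrite -BI flattenK.
rewrite mem_compositions -BI size_flatten eqxx andbT; apply/andP; split.
  by case: B BI {Bn} I0 => // <-.
by rewrite all_map; apply: sub_all Bn => b /=; rewrite -size_eq0 lt0n.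
Qed.

Definition pi_u (I : seq nat) : nat :=
  (\prod_(j < size I) sumn (take j.+1 I))%N.

(* The product of the pi_u (I_a) when I refines J. When I has positive parts,
   the decomposition I = I_1 .. I_m is unique, so that [head] makes no choice. *)
Definition pi_u2 (I J : seq nat) : nat :=
  (\prod_(b <- head [::] [seq B <- splittings I | map sumn B == J]) pi_u b)%N.

(* Main.v *)
Require Import Defs.
From HB Require Import structures.
From mathcomp Require Import all_boot all_order all_algebra.
From mathcomp Require Import boolp.

(** Let g(t) be the series of operators v |-> v(G_t). It is the exponential of d(t), and
    a_t = -d(t) z, so each formula for a_t is the logarithm of a series of operators,
    expanded over compositions and applied to z.

    Linear endomorphisms of K<<z>> form a Q-algebra E, and all the series of operators
    live in E[[t]]. There d = log g = - sum_I (-1)^l(I)/l(I) t^|I| s^I: by [log_texp]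
    this follows from the polynomial congruence log (exp X) = X modulo X^(N+1), which is
    checked by taking derivatives ([log_exp_poly]). This is the formula in the s_m. The
    formula in the lambda_m is the same statement for f(-t), the inverse of g and thus
    exp (-d); the invertibility is [substK], which says that substitutions compose.

    The other two formulas come from differential equations. By the chain rule
    [dt_subst], g' = g h and g' = m g. Comparing coefficients expresses each s_k as a
    sum over the compositions I of k, with coefficients 1/pi_u(I) on psi^I
    ([pi_u_rec_right]) and 1/pi_u(rev I) on xi^I ([pi_u_rec_left]). Substituting this
    into the formula in the s_m turns every part of J into a block; the coefficient of
    psi^I is a sum over the ways to cut I into blocks ([sum_prod_refine]), which are the
    J refined by I ([sum_refines_splittings]). *)

Set Implicit Arguments.
Unset Strict Implicit.
Unset Printing Implicit Defensive.

Import Order.TTheory GRing.Theory Num.Theory.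

Local Open Scope ring_scope.

(** * Compositions *)

(** The empty sequence counts as the composition of 0 here: removing the first
    or the last part of a composition of k.+1 then always leaves an element of
    [comps], which is what the recursions below need. *)
Definition comps (k : nat) : seq (seq nat) :=
  if k is 0 then [:: [::]] else compositions k.

Lemma mem_comps k I : (I \in comps k) = all (leq 1) I && (sumn I == k).
Proof.
case: k => [|k]; last by rewrite mem_compositions; case: I.
rewrite inE; case: I => [|[|i] I] //=; exact/esym/andbF.
Qed.

Lemma comps_uniq k : uniq (comps k).
Proof. by case: k => // k; apply: compositions_uniq. Qed.

Lemma comps_size k I : I \in comps k -> (size I <= k)%N.
Proof.
rewrite mem_comps => /andP[+ /eqP <-].
elim: I => //= i I IHI /andP[i1 /IHI sI].
by rewrite -addn1 addnC leq_add.
Qed.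

Lemma comps_cons k :
  perm_eq (comps k.+1) [seq i.+1 :: J | i <- iota 0 k.+1, J <- comps (k - i)].
Proof.
apply: uniq_perm; first exact: comps_uniq.
  apply: allpairs_uniq_dep => [|i _|]; rewrite ?iota_uniq ?comps_uniq //.
  by move=> [i I] [j J] _ _ /= [-> ->].
move=> I; rewrite mem_comps; apply/idP/allpairsPdep.
  case: I => [|[|i] I] //= /andP[I1 /eqP e].
  have ik: (i <= k)%N by move: e; rewrite addSn => -[<-]; apply: leq_addr.
  exists i, I; split=> //; first by rewrite -[_ :: _]/(iota 0 k.+1) mem_iota ltnS.
  rewrite mem_comps I1 /=.
  by move: e; rewrite addSn => -[<-]; rewrite addKn.
move=> [i [J [+ + ->]]]; rewrite mem_iota mem_comps ltnS => /= ik.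
case/andP=> -> /eqP ->.
by rewrite addSn subnKC ?eqxx.
Qed.

Lemma comps_rev k : perm_eq (comps k) [seq rev J | J <- comps k].
Proof.
apply: uniq_perm; rewrite ?(map_inj_uniq (inv_inj revK)) ?comps_uniq // => I.
by rewrite -[I in RHS]revK (mem_map (inv_inj revK)) !mem_comps sumn_rev all_rev.
Qed.

Lemma sum_comps_cons (V : nmodType) k (F : seq nat -> V) :
  \sum_(I <- comps k.+1) F I =
  \sum_(i < k.+1) \sum_(J <- comps (k - i)) F (i.+1 :: J).
Proof.
rewrite (perm_big _ (comps_cons k)) big_allpairs_dep.
by rewrite -(big_mkord xpredT (fun i => \sum_(J <- comps (k - i)) F (i.+1 :: J))).
Qed.

Lemma sum_comps_rcons (V : nmodType) k (F : seq nat -> V) :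
  \sum_(I <- comps k.+1) F I =
  \sum_(i < k.+1) \sum_(J <- comps (k - i)) F (rcons J i.+1).
Proof.
rewrite (perm_big _ (comps_rev _)) big_map sum_comps_cons.
apply: eq_bigr => i _; rewrite [RHS](perm_big _ (comps_rev _)) big_map.
by apply: eq_bigr => J _; rewrite rev_cons.
Qed.

(** * Power series in t over a noncommutative ring *)
Section TruncatedSeries.
Variable E : nzRingType.
Implicit Types x y : tser E.

Lemma tser_mulE x y k : (x * y) k = \sum_(i < k.+1) x i * y (k - i)%N.
Proof.
transitivity (\sum_(p <- nat_splits k) x p.1 * y p.2) => //; rewrite big_map.
by rewrite -(big_mkord xpredT (fun i => x i * y (k - i)%N)).
Qed.

Lemma tser_sumE (I : Type) (r : seq I) (P : pred I) (F : I -> tser E) k :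
  (\sum_(i <- r | P i) F i) k = \sum_(i <- r | P i) F i k.
Proof. exact: (big_morph (fun x : tser E => x k)). Qed.

(** Since x has no constant term, expanding the l-fold product leaves one term
    for each way to write k as a sum of l positive integers. *)
Lemma tser_expE x l k : x 0%N = 0 ->
  (x ^+ l) k = \sum_(I <- comps k | size I == l) \prod_(i <- I) x i.
Proof.
move=> x0; elim: l k => [|l IHl] k.
  rewrite expr0 [LHS]/((k == 0%N)%:R); case: k => [|k].
    by rewrite big_cons !big_nil addr0.
  by rewrite big_seq_cond big1 // => -[|i I]; rewrite mem_comps andbF.
rewrite exprS tser_mulE; case: k => [|k].
  by rewrite big_ord1 x0 mul0r big_cons /= big_nil.
rewrite big_ord_recl x0 mul0r add0r [RHS]big_mkcond sum_comps_cons.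
apply: eq_bigr => i _; rewrite -big_mkcond /= subSS IHl mulr_sumr.
by apply: eq_big => // J _; rewrite big_cons.
Qed.

Lemma tser_exp_small x l k : x 0%N = 0 -> (k < l)%N -> (x ^+ l) k = 0.
Proof.
move=> x0 kl; rewrite tser_expE // big_seq_cond big1 // => I /andP[/comps_size].
by move=> /leq_ltn_trans/(_ kl) /[swap] /eqP ->; rewrite ltnn.
Qed.

(** Congruence modulo t^(N+1), which is compatible with products. *)
Definition eq_upto N x y := forall k, (k <= N)%N -> x k = y k.

Lemma eq_uptoM N x x' y y' : eq_upto N x x' -> eq_upto N y y' -> eq_upto N (x * y) (x' * y').
Proof.
move=> ex ey k kN; rewrite !tser_mulE; apply: eq_bigr => i _.
rewrite ex ?ey // ?(leq_trans (leq_subr _ _)) //.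
by rewrite (leq_trans _ kN) // -ltnS.
Qed.

Lemma eq_uptoX N x y l : eq_upto N x y -> eq_upto N (x ^+ l) (y ^+ l).
Proof.
by move=> exy; elim: l => // l IHl; rewrite !exprS; apply: eq_uptoM.
Qed.

End TruncatedSeries.

(** * Truncated exponential and logarithm *)
Section Polynomials.
Implicit Types p : {poly rat}.

(** The Taylor polynomials of exp X to degree N and of log (1 + X), whose terms
    are written X^(l+1)/(l+1) with sign (-1)^l, to degree N. *)
Definition exp_poly N : {poly rat} := \sum_(j < N.+1) (j`!%:R^-1) *: 'X^j.
Definition log_poly N : {poly rat} :=
  \sum_(l < N) ((-1) ^+ l / l.+1%:R) *: 'X^(l.+1).

(** Characteristic 0 lets an identity modulo X^(N+1) be checked on derivatives,
    modulo X^N, and on constant terms. *)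
Lemma dvdp_Xn_deriv N p : 'X^N %| p^`() -> p.[0] = 0 -> 'X^(N.+1) %| p.
Proof.
move=> /dvdpP[q dp] p0; apply/dvdpP; exists (drop_poly N.+1 p).
rewrite -{1}(poly_take_drop N.+1 p) [X in X + _](_ : _ = 0) ?add0r //.
apply/polyP => i; rewrite coef_take_poly coef0; case: ltnP => // iN.
case: i iN => [|i iN]; first by rewrite -horner_coef0.
have /eqP : p^`()`_i = 0 by rewrite dp coefMXn -ltnS iN.
by rewrite coef_deriv mulrn_eq0 => /eqP.
Qed.

Lemma exp_poly0 N : (exp_poly N).[0] = 1.
Proof.
rewrite /exp_poly horner_sum big_ord_recl big1 => [|i _].
  by rewrite hornerZ hornerXn expr0 mulr1 fact0 invr1 addr0.
by rewrite hornerZ hornerXn exprS mul0r mulr0.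
Qed.

Lemma deriv_exp_poly N :
  (exp_poly N)^`() = exp_poly N - (N`!%:R^-1) *: 'X^N.
Proof.
rewrite /exp_poly [in RHS]big_ord_recr /= addrK raddf_sum big_ord_recl /=.
rewrite derivZ derivXn mulr0n scaler0 add0r; apply: eq_bigr => i _.
rewrite derivZ derivXn /= -scaler_nat scalerA; congr (_ *: _).
rewrite /bump /= add1n factS natrM invfM mulrAC mulVf ?mul1r //.
by rewrite pnatr_eq0.
Qed.

(** With e = exp_poly N and L = log_poly N, the derivative of L(e - 1) is
    L'(e - 1) e'. Here e' is e up to a multiple of X^N, and (1 + X) L' is the
    geometric sum 1 - (-X)^N, so that L'(e - 1) e = 1 - (1 - e)^N. As X divides
    1 - e, the derivative is 1 modulo X^N. *)
Lemma log_exp_poly N : 'X^(N.+1) %| log_poly N \Po (exp_poly N - 1) - 'X.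
Proof.
set e := exp_poly N.
(* The constant term of e is 1. *)
have Xe : 'X %| e - 1.
  by rewrite -['X]subr0 -polyC0 dvdp_XsubCl rootE !hornerE exp_poly0 subrr.
apply: dvdp_Xn_deriv; last first.
  rewrite !hornerE horner_comp /log_poly !hornerE exp_poly0 subrr.
  by rewrite horner_sum big1 // => i _; rewrite !hornerE exprS mul0r mulr0.
have dlog : (1 + 'X) * (log_poly N)^`() = 1 - (- 'X) ^+ N.
  rewrite -[RHS]opprB subrX1 -mulNr opprB opprK; congr (_ * _).
  rewrite /log_poly raddf_sum; apply: eq_bigr => i _ /=.
  rewrite derivZ derivXn /= -scaler_nat scalerA divfK ?pnatr_eq0 //.
  by rewrite [RHS]exprNn -mul_polyC polyC_exp polyCN.
have {dlog}/(congr1 (comp_poly (e - 1))) := dlog.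
rewrite !rmorphM !rmorphB rmorphD rmorph1 /= comp_polyX addrC subrK rmorphXn rmorphN /=.
rewrite comp_polyX => dlog.
rewrite derivB deriv_comp derivX derivB derivC subr0 deriv_exp_poly.
rewrite mulrBr mulrC dlog addrAC [1 - _]addrC addrK.
rewrite dvdp_sub // ?dvdpNr ?dvdp_exp2r ?dvdpNr //.
by rewrite dvdp_mull // -mul_polyC dvdp_mull.
Qed.

(** The derivative of exp X exp (-X) vanishes, and the truncation only adds
    multiples of X^N to it. *)
Lemma exp_polyN N : 'X^(N.+1) %| exp_poly N * (exp_poly N \Po - 'X) - 1.
Proof.
set e := exp_poly N.
apply: dvdp_Xn_deriv; last first.
  by rewrite !hornerE horner_comp !hornerE oppr0 !exp_poly0 mulr1 subrr.
rewrite derivB derivC subr0 derivM deriv_comp deriv_exp_poly derivN derivX.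
rewrite mulrN1 comp_polyB comp_polyZ rmorphXn /= comp_polyX -/e.
rewrite opprB mulrBl mulrBr addrA.
rewrite -addrA addrC addrA addrNK addrC.
apply: dvdp_add; last by rewrite -mul_polyC !dvdp_mull // dvdp_exp2r ?dvdpNr.
by rewrite dvdpNr -mul_polyC -mulrA dvdp_mull // dvdp_mulr.
Qed.

End Polynomials.

(** * Exponential and logarithm in E[[t]] *)
Section ExpLog.
Variable E : algType rat.
Implicit Types x y d f g : tser E.

(** E[[t]] only carries a scaling by E; the rational constants are central, which
    is what makes evaluation of rational polynomials at x a ring morphism. *)
Definition qconst : {rmorphism rat -> tser E} :=
  [the {rmorphism _ -> _} of GRing.in_alg (tser E) \o GRing.in_alg E].

Lemma qconst_mulE q x k : (qconst q * x) k = q *: x k.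
Proof. by rewrite /= mulr_algl [LHS]mulr_algl. Qed.

Lemma qconst_comm x : commr_rmorph qconst x.
Proof.
move=> q; apply/funext => k; rewrite qconst_mulE tser_mulE.
have qE j : qconst q j = q%:A * (j == 0%N)%:R by [].
rewrite big_ord_recr big1 => [|i _]; rewrite qE /=.
  by rewrite subnn add0r mulr1 mulr_algr.
by rewrite subn_eq0 leqNgt ltn_ord mulr0 mulr0.
Qed.

Definition peval x : {poly rat} -> tser E := horner_morph (qconst_comm x).
HB.instance Definition _ x := GRing.RMorphism.on (peval x).

Lemma pevalX x : peval x 'X = x.
Proof. exact: horner_morphX. Qed.

Lemma pevalC x q : peval x q%:P = qconst q.
Proof. exact: horner_morphC. Qed.

Lemma pevalZXn x q i : peval x (q *: 'X^i) = qconst q * x ^+ i.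
Proof. by rewrite -mul_polyC rmorphM rmorphXn /= pevalX pevalC. Qed.

(** x has no constant term, so that X^N evaluates to a multiple of t^N. *)
Lemma peval_small x N p k : x 0%N = 0 -> 'X^N %| p -> (k < N)%N ->
  peval x p k = 0.
Proof.
move=> x0 /dvdpP[q ->] kN; rewrite rmorphM rmorphXn /= pevalX tser_mulE.
apply: big1 => i _; rewrite [X in _ * X]tser_exp_small ?mulr0 //.
exact: leq_ltn_trans (leq_subr _ _) kN.
Qed.

(** The terms d^j / j! with j > k do not contribute to the coefficient of t^k, as
    [d] is meant to have no constant term. *)
Definition texp d : tser E := fun k => \sum_(j < k.+1) j`!%:R^-1 *: (d ^+ j) k.

(** The bridge between series and polynomials: modulo t^(N+1), [texp d] is the
    value at d of a polynomial, so identities between polynomials modulo X^(N+1)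
    transfer to identities in E[[t]]. *)
Lemma texp_peval d N : d 0%N = 0 -> eq_upto N (texp d) (peval d (exp_poly N)).
Proof.
move=> d0 k kN; rewrite /exp_poly rmorph_sum tser_sumE.
rewrite (eq_bigr (fun j : 'I_N.+1 => j`!%:R^-1 *: (d ^+ j) k)); last first.
  by move=> j _; rewrite /= pevalZXn qconst_mulE.
rewrite [RHS](bigID (fun j : 'I_N.+1 => (j < k.+1)%N)) /=.
rewrite [X in _ + X]big1 => [|j]; last first.
  by rewrite -leqNgt => kj; rewrite tser_exp_small ?scaler0.
rewrite addr0 /texp.
by rewrite -(big_ord_widen N.+1 (fun j => j`!%:R^-1 *: (d ^+ j) k)).
Qed.

Lemma texpN d : d 0%N = 0 -> texp d * texp (- d) = 1.
Proof.
move=> d0; apply/funext => k.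
have Nd0 : (- d) 0%N = 0 by rewrite -[LHS]/(- d 0%N) d0 oppr0.
rewrite (eq_uptoM (texp_peval d0) (texp_peval Nd0) (leqnn k)).
have -> : peval (- d) (exp_poly k) = peval d (exp_poly k \Po - 'X).
  rewrite /exp_poly !rmorph_sum; apply: eq_bigr => j _ /=.
  rewrite comp_polyZ rmorphXn /= comp_polyX.
  by rewrite pevalZXn -mul_polyC rmorphM rmorphXn rmorphN /= pevalC pevalX.
rewrite -rmorphM; apply/eqP; rewrite -subr_eq0; apply/eqP.
rewrite -[LHS]/((peval d _ - 1) k) -(rmorph1 (peval d)) -rmorphB.
exact: peval_small (exp_polyN _) _.
Qed.

Lemma texp_left_inv d f : d 0%N = 0 -> f * texp d = 1 -> f = texp (- d).
Proof.
move=> d0 fd; rewrite -[f]mulr1 -(texpN d0) mulrA fd mul1r //.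
Qed.

(** d = log (1 + x) for x = texp d - 1. The coefficient of t^k in the power x^l is
    a sum over the compositions of k with l parts, and summing over l collects all
    compositions of k. *)
Lemma log_texp d k : d 0%N = 0 ->
  d k = \sum_(I <- compositions k)
          (- ((-1) ^+ size I / (size I)%:R)) *: \prod_(i <- I) texp d i.
Proof.
case: k => [|k] d0; first by rewrite big_nil.
set x := texp d - 1.
have x0 : x 0%N = 0.
  rewrite -[LHS]/(texp d 0%N - 1) /texp big_ord1 expr0 fact0 invr1 scale1r.
  exact: subrr.
have xk i : x i.+1 = texp d i.+1 by apply: subr0.
have -> : d k.+1 = \sum_(l < k.+1) ((-1) ^+ l / l.+1%:R) *: (x ^+ l.+1) k.+1.
  have := peval_small d0 (log_exp_poly k.+1) (ltnSn _).
  rewrite rmorphB /= pevalX.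
  move=> /eqP; rewrite [X in X == _]/(peval d _ k.+1 - d k.+1) subr_eq0.
  move=> /eqP <-; rewrite /log_poly !rmorph_sum tser_sumE.
  apply: eq_bigr => l _ /=.
  rewrite comp_polyZ rmorphXn /= comp_polyX -mul_polyC rmorphM rmorphXn /=.
  rewrite pevalC qconst_mulE; congr (_ *: _).
  apply: eq_uptoX (leqnn _) => i ik; rewrite rmorphB rmorph1.
  by rewrite -[LHS]/(peval d _ i - (1 : tser E) i) -(texp_peval d0).
under eq_bigr do rewrite tser_expE // scaler_sumr.
rewrite (exchange_big_dep xpredT) // -[comps _]/(compositions k.+1).
rewrite big_seq [RHS]big_seq; apply: eq_bigr => -[|i J] Jk.
  by move: Jk; rewrite mem_compositions.
have Jsize : (size J < k.+1)%N by apply: (comps_size (k := k.+1) Jk).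
rewrite (big_pred1 (Ordinal Jsize)) => [|l]; last by rewrite /= eqSS eq_sym.
rewrite /= exprS mulN1r mulNr opprK; congr (_ *: _).
apply: eq_big_seq => j jJ.
have : (0 < j)%N.
  by move: Jk; rewrite mem_compositions => /and3P[_ /allP/(_ _ jJ)].
by case: j {jJ}.
Qed.
End ExpLog.

(** * Linear differential equations in E[[t]] *)

Lemma pi_u_rcons I j : pi_u (rcons I j) = (pi_u I * (sumn I + j))%N.
Proof.
rewrite /pi_u size_rcons big_ord_recr /= -(size_rcons I j) take_size sumn_rcons.
congr (_ * _)%N; apply: eq_bigr => i _.
by rewrite -cats1 takel_cat.
Qed.

Section Recurrences.
Variable E : algType rat.
Implicit Types g p : tser E.

(** The hypothesis says g' = g p', where p' has coefficient p_(k+1) at t^k. Solving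
    for g_k divides by k = |I| and puts a new factor p_i on the right, hence the
    product of the partial sums from the left. *)
Lemma pi_u_rec_right g p :
  g 0%N = 1 ->
  (forall k, g k.+1 *+ k.+1 = \sum_(i < k.+1) g i * p (k - i)%N.+1) ->
  forall k, g k = \sum_(I <- comps k) (pi_u I)%:R^-1 *: \prod_(i <- I) p i.
Proof.
move=> g0 g_rec k; have [m] := ubnP k; elim: m k => // m IHm [_|k].
  by rewrite /= big_seq1 big_nil g0 /pi_u big_ord0 invr1 scale1r.
rewrite ltnS => km; rewrite sum_comps_rcons.
have -> : g k.+1 = k.+1%:R^-1 *: (g k.+1 *+ k.+1).
  by rewrite -scaler_nat scalerA mulVf ?scale1r // pnatr_eq0.
rewrite g_rec scaler_sumr (reindex_inj rev_ord_inj); apply: eq_bigr => i _.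
rewrite /= subSS subKn -1?ltnS // IHm; last by apply: leq_ltn_trans (leq_subr _ _) km.
rewrite mulr_suml scaler_sumr big_seq [RHS]big_seq; apply: eq_bigr => J.
rewrite mem_comps => /andP[_ /eqP sJ].
rewrite big_rcons /= -scalerAl scalerA pi_u_rcons sJ addnS subnK -1?ltnS //.
by rewrite natrM invfM mulrC.
Qed.

(** The mirror image, for g' = p' g: new factors appear on the left, so that the
    partial sums are those of the reversed composition. *)
Lemma pi_u_rec_left g p :
  g 0%N = 1 ->
  (forall k, g k.+1 *+ k.+1 = \sum_(i < k.+1) p i.+1 * g (k - i)%N) ->
  forall k, g k = \sum_(I <- comps k) (pi_u (rev I))%:R^-1 *: \prod_(i <- I) p i.
Proof.
move=> g0 g_rec k; have [m] := ubnP k; elim: m k => // m IHm [_|k].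
  by rewrite /= big_seq1 big_nil g0 /pi_u big_ord0 invr1 scale1r.
rewrite ltnS => km; rewrite sum_comps_cons.
have -> : g k.+1 = k.+1%:R^-1 *: (g k.+1 *+ k.+1).
  by rewrite -scaler_nat scalerA mulVf ?scale1r // pnatr_eq0.
rewrite g_rec scaler_sumr; apply: eq_bigr => i _.
rewrite IHm; last by apply: leq_ltn_trans (leq_subr _ _) km.
rewrite mulr_sumr scaler_sumr big_seq [RHS]big_seq; apply: eq_bigr => J.
rewrite mem_comps => /andP[_ /eqP sJ].
rewrite big_cons rev_cons pi_u_rcons sumn_rev sJ addnS subnK -1?ltnS //.
by rewrite -scalerAr scalerA natrM invfM mulrC.
Qed.

End Recurrences.

(** * Refinements as sequences of blocks *)

Lemma compositionsP k I :
  I \in compositions k -> [/\ I != [::], all (leq 1) I & sumn I = k].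
Proof. by rewrite mem_compositions => /and3P[? ? /eqP]. Qed.

Definition block_seq (B : seq (seq nat)) : bool :=
  all (fun b => (b != [::]) && all (leq 1) b) B.

(** Positive parts make the blocks readable off the concatenation: the first block
    is the prefix whose sum is the first block sum. This is why a refinement
    I of J determines the decomposition I_1 .. I_m. *)
Lemma block_seq_inj B B' : block_seq B -> block_seq B' ->
  flatten B = flatten B' -> map sumn B = map sumn B' -> B = B'.
Proof.
have pre b r b' r' : all (leq 1) b' -> b ++ r = b' ++ r' ->
    sumn b = sumn b' -> (size b <= size b')%N -> b = b'.
  move=> b'1 e es sb.
  have db : b = take (size b) b'.
    by move/(congr1 (take (size b))): e; rewrite take_size_cat // takel_cat.
  have := cat_take_drop (size b) b'; rewrite -db; move: (drop _ _) => s eb'.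
  move: b'1 es; rewrite -eb' sumn_cat all_cat => /andP[_ s1] /eqP.
  rewrite -{1}[sumn b]addn0 eqn_add2l eq_sym; case: s s1 {eb'} => [|j s] /=.
    by rewrite cats0.
  by case: j.
elim: B B' => [|b B IHB] [|b' B'] //= /andP[/andP[_ b1] B1] /andP[/andP[_ b1'] B1'].
move=> e [es esB].
have eb : b = b'.
  have [sb|/ltnW sb] := leqP (size b) (size b'); first exact: pre e es sb.
  by apply/esym/(pre _ _ _ _ b1 (esym e)).
rewrite eb; congr (_ :: _); apply: IHB => //.
by move: e; rewrite eb => /eqP; rewrite eqseq_cat // eqxx => /eqP.
Qed.

Lemma flatten_blocks B : block_seq B -> B != [::] ->
  flatten B \in compositions (sumn (flatten B)).
Proof.
move=> Bb B0; rewrite mem_compositions eqxx andbT; apply/andP; split.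
  by case: B Bb B0 => // -[|i b] B.
apply/allP => i /flattenP[b bB ib].
by have /andP[_ /allP/(_ _ ib)] := allP Bb _ bB.
Qed.

Lemma sumn_blocks B : block_seq B -> B != [::] ->
  map sumn B \in compositions (sumn (flatten B)).
Proof.
move=> Bb B0; rewrite mem_compositions sumn_flatten eqxx andbT; apply/andP; split.
  by case: B Bb B0.
rewrite all_map; apply: sub_all Bb => b /= /andP[].
by case: b => //= i b _ /andP[i0 _]; apply: leq_trans i0 (leq_addr _ _).
Qed.

Lemma mem_splittings I B : I != [::] -> all (leq 1) I ->
  (B \in splittings I) = block_seq B && (flatten B == I).
Proof.
move=> I0 I1; apply/mapP/andP => [[s]|[Bb /eqP BI]].
  rewrite mem_compositions => /and3P[_ s1 /eqP es] ->.
  have eI : flatten (reshape s I) = I by rewrite reshapeKr ?es.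
  split; last exact/eqP.
  apply/allP => b bs; apply/andP; split; last first.
    apply/allP => i ib; apply: (allP I1); rewrite -eI.
    by apply/flattenP; exists b.
  have /allP/(_ (size b)) : all (leq 1) (shape (reshape s I)) by rewrite reshapeKl ?es.
  by rewrite -size_eq0 -lt0n; apply; apply: map_f.
exists (shape B); last by rewrite -BI flattenK.
rewrite mem_compositions -BI size_flatten eqxx andbT; apply/andP; split.
  by case: B BI {Bb} I0 => // <-.
by rewrite all_map; apply: sub_all Bb => b /= /andP[+ _]; rewrite -size_eq0 lt0n.
Qed.

Lemma splittings_uniq I : uniq (splittings I).
Proof.
rewrite map_inj_in_uniq ?compositions_uniq // => s s'.
rewrite !mem_compositions => /and3P[_ _ /eqP es] /and3P[_ _ /eqP es'].
by move=> /(congr1 shape); rewrite !reshapeKl ?es ?es'.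
Qed.

(** The J refined by I are the sequences of block sums of the splittings of I, and
    distinct splittings have distinct block sums. *)
Lemma sum_refines_splittings (V : nmodType) I (F : seq nat -> V) :
  I != [::] -> all (leq 1) I ->
  \sum_(J <- compositions (sumn I) | refines I J) F J =
  \sum_(B <- splittings I) F (map sumn B).
Proof.
move=> I0 I1; rewrite -big_filter -(big_map (map sumn) xpredT F).
apply: perm_big; apply: uniq_perm.
- by rewrite filter_uniq ?compositions_uniq.
- rewrite map_inj_in_uniq ?splittings_uniq // => B B'.
  rewrite !mem_splittings // => /andP[Bb /eqP BI] /andP[Bb' /eqP BI'].
  by apply: block_seq_inj; rewrite ?BI.
move=> J; rewrite mem_filter mem_compositions /refines.
have [/mapP[B + ->]|//] := boolP (_ \in _); rewrite mem_splittings // => /andP[Bb /eqP BI].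
rewrite -mem_compositions -BI sumn_blocks //.
by case: B BI {Bb} I0 => // <-.
Qed.

Lemma pi_u2_blocks B : block_seq B -> B != [::] ->
  pi_u2 (flatten B) (map sumn B) = (\prod_(b <- B) pi_u b)%N.
Proof.
move=> Bb B0; rewrite /pi_u2.
have [I0 I1 _] := compositionsP (flatten_blocks Bb B0).
have : B \in [seq B' <- splittings (flatten B) | map sumn B' == map sumn B].
  by rewrite mem_filter eqxx mem_splittings // Bb eqxx.
case es: (filter _ _) => [|B' s'] // _ /=.
have := mem_head B' s'; rewrite -es.
rewrite mem_filter mem_splittings // => /and3P[/eqP e Bb' /eqP e'].
by rewrite (block_seq_inj Bb' Bb e' e).
Qed.

(** Reversing I and J reverses the order of the blocks, which the product does not
    see, and each block. *)
Lemma pi_u2_blocks_rev B : block_seq B -> B != [::] ->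
  pi_u2 (rev (flatten B)) (rev (map sumn B)) = (\prod_(b <- B) pi_u (rev b))%N.
Proof.
move=> Bb B0; have -> : rev (map sumn B) = map sumn (rev (map rev B)).
  by rewrite map_rev -map_comp (eq_map (g := sumn)) // => b /=; rewrite sumn_rev.
rewrite rev_flatten pi_u2_blocks.
- by rewrite (perm_big _ (permEl (perm_rev _))) big_map.
- rewrite /block_seq all_rev all_map; apply: sub_all Bb => b /=.
  by rewrite all_rev -!size_eq0 size_rev.
by rewrite -size_eq0 size_rev size_map size_eq0.
Qed.

Fixpoint blocks (J : seq nat) : seq (seq (seq nat)) :=
  if J is j :: J' then [seq b :: B | b <- compositions j, B <- blocks J']
  else [:: [::]].

Lemma mem_blocks J B : (B \in blocks J) = block_seq B && (map sumn B == J).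
Proof.
elim: J B => [|j J IHJ] [|b B] //=; rewrite ?andbF //.
  by apply/allpairsP => -[[? ?] [] ].
apply/allpairsP/idP => [[[b' B'] /= [+ + [-> ->]]]|].
  rewrite mem_compositions IHJ => /and3P[-> -> /eqP ->] /andP[/= -> /eqP ->].
  by rewrite eqxx.
case/andP=> /andP[/andP[b0 b1] Bb] /eqP[bj BJ]; exists (b, B).
by rewrite mem_compositions IHJ Bb b0 b1 bj BJ !eqxx.
Qed.

Lemma blocks_uniq J : uniq (blocks J).
Proof.
elim: J => //= j J IHJ; apply: allpairs_uniq; rewrite ?compositions_uniq //.
by move=> [? ?] [? ?] _ _ [-> ->].
Qed.

(** Both sides run over all nonempty sequences B of compositions of total weight k:
    on the left by block sums, on the right by concatenation. *)
Lemma sum_blocks (V : nmodType) k (F : seq (seq nat) -> V) :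
  \sum_(J <- compositions k) \sum_(B <- blocks J) F B =
  \sum_(I <- compositions k) \sum_(B <- splittings I) F B.
Proof.
rewrite -!(big_allpairs_dep (h := fun _ B => B)).
apply: perm_big; apply: uniq_perm.
- apply: allpairs_uniq_dep => [|J _|]; rewrite ?compositions_uniq ?blocks_uniq //.
  move=> [J B] [J' B'] /allpairsPdep[? [? [_ + [-> ->]]]].
  move=> /[swap] /allpairsPdep[? [? [_ + [-> ->]]]] /=.
  by rewrite !mem_blocks => /andP[_ /eqP <-] /andP[_ /eqP <-] ->.
- apply: allpairs_uniq_dep => [|I _|]; rewrite ?compositions_uniq ?splittings_uniq //.
  move=> [J B] [J' B'] /allpairsPdep[? [? [+ + [-> ->]]]].
  move=> /compositionsP[J0 J1 _].
  rewrite mem_splittings // => /andP[_ /eqP <-].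
  move=> /allpairsPdep[? [? [+ + [-> ->]]]].
  move=> /compositionsP[J0' J1' _].
  by rewrite mem_splittings // => /andP[_ /eqP <-] /= ->.
move=> B; apply/allpairsPdep/allpairsPdep => -[J [B' [+ + ->]]].
  rewrite mem_blocks => + /andP[Bb /eqP BJ]; rewrite -BJ => Jk.
  have B0 : B' != [::] by case: B' Jk {Bb BJ} => //; rewrite mem_compositions.
  have Bk : sumn (flatten B') = k.
    by move: Jk; rewrite mem_compositions -sumn_flatten => /and3P[_ _ /eqP].
  have := flatten_blocks Bb B0; rewrite Bk => Ik; exists (flatten B'), B'.
  have [I0 I1 _] := compositionsP Ik.
  by rewrite mem_splittings // Bb eqxx.
move=> Ik; have [I0 I1 sk] := compositionsP Ik.
rewrite mem_splittings // => /andP[Bb /eqP BI].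
have B0 : B' != [::] by case: B' BI I0 {Bb} => // <-.
exists (map sumn B'), B'; rewrite mem_blocks Bb eqxx; split=> //.
by rewrite -sk -BI sumn_blocks.
Qed.

Section Substitution.
Variables (E : algType rat) (g p : nat -> E) (w : seq nat -> rat).
Hypothesis gE : forall k, (0 < k)%N ->
  g k = \sum_(I <- compositions k) w I *: \prod_(i <- I) p i.

Lemma prod_blocks J : all (leq 1) J ->
  \prod_(j <- J) g j =
  \sum_(B <- blocks J) (\prod_(b <- B) w b) *: \prod_(i <- flatten B) p i.
Proof.
elim: J => [_|j J IHJ /= /andP[j0 J1]].
  by rewrite /= big_seq1 !big_nil scale1r.
rewrite big_cons gE // IHJ // big_allpairs_dep mulr_suml; apply: eq_bigr => b _.
rewrite mulr_sumr; apply: eq_bigr => B _.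
by rewrite /= !big_cons big_cat /= -scalerAl -scalerAr scalerA.
Qed.

(** Substituting the expansion of each g_j in terms of p into a sum over
    compositions J replaces each part of J by a block, so that the coefficient
    of p^I collects one term for each splitting of I into blocks. *)
Lemma sum_prod_refine (c : nat -> rat) k :
  \sum_(J <- compositions k) c (size J) *: \prod_(j <- J) g j =
  \sum_(I <- compositions k)
    (\sum_(B <- splittings I) c (size B) * \prod_(b <- B) w b) *: \prod_(i <- I) p i.
Proof.
transitivity (\sum_(J <- compositions k) \sum_(B <- blocks J)
    (c (size B) * \prod_(b <- B) w b) *: \prod_(i <- flatten B) p i).
  rewrite big_seq [RHS]big_seq; apply: eq_bigr => J.
  move=> /compositionsP[_ J1 _]; rewrite prod_blocks // scaler_sumr.
  rewrite big_seq [RHS]big_seq; apply: eq_bigr => B.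
  by rewrite mem_blocks scalerA => /andP[_ /eqP <-]; rewrite size_map.
rewrite sum_blocks big_seq [RHS]big_seq; apply: eq_bigr => I.
move=> /compositionsP[I0 I1 _]; rewrite scaler_suml.
rewrite big_seq [RHS]big_seq; apply: eq_bigr => B.
by rewrite mem_splittings // => /andP[_ /eqP ->].
Qed.

End Substitution.

(** * Substitution and derivations of power series in z *)
Section PowerSeries.
Variables (c : kind) (n : nat) (R : nzRingType).
Local Notation S := (zser c n R).
Implicit Types (u v : S) (F N : 'I_n -> S).

Lemma zser_mulE u v m : (u * v) m = \sum_(p <- splits m) u p.1 * v p.2.
Proof. by []. Qed.

Lemma zser_sumE (I : Type) (r : seq I) (P : pred I) (G : I -> S) m :
  (\sum_(i <- r | P i) G i) m = \sum_(i <- r | P i) G i m.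
Proof. exact: (big_morph (fun x : S => x m)). Qed.

Definition monomial (w : mon c n) : S := fun m => (m == w)%:R.

Lemma monomialM a b : monomial a * monomial b = monomial (mmul a b).
Proof.
apply/funext => m; rewrite zser_mulE /monomial.
under eq_bigr => p _ do rewrite -natrM mulnb.
rewrite eq_sym -[_ == m](mem_mon_splits m (a, b)).
have [abm|abm] := boolP (_ \in _).
  rewrite (bigD1_seq (a, b)) ?splits_uniq //= !eqxx big1 ?addr0 // => -[x y].
  by rewrite xpair_eqE => /negPf ->.
rewrite big_seq big1 // => -[x y] xym.
by case: andP abm xym => // -[/= /eqP -> /eqP ->] /negPf ->.
Qed.

Lemma prod_z w : \prod_(i <- w) z i = monomial (mword c w).
Proof.
elim: w => [|i w IHw].
  by rewrite big_nil; congr monomial; apply: val_inj; rewrite /= normalize_id ?normal_nil.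
rewrite big_cons IHw [z i]/(monomial _) monomialM; congr monomial.
by apply: val_inj; rewrite /= -cat1s normalize_catr.
Qed.

Lemma prod_word (w : mon c n) : \prod_(i <- word w) z i = monomial w.
Proof.
by rewrite prod_z; congr monomial; case: w => w nw; apply: val_inj; rewrite /= normalize_id.
Qed.

Lemma order_geW k l u : (l <= k)%N -> order_ge k u -> order_ge l u.
Proof. by move=> lk uk m ml; apply: uk; apply: leq_trans lk. Qed.

Lemma order_geD k u v : order_ge k u -> order_ge k v -> order_ge k (u + v).
Proof.
by move=> uk vk m mk; rewrite -[LHS]/(u m + v m) uk // vk // addr0.
Qed.

Lemma order_geM k l u v : order_ge k u -> order_ge l v -> order_ge (k + l) (u * v).
Proof.
move=> uk vl m mkl; rewrite zser_mulE big_seq big1 // => p.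
rewrite mem_splits => /eqP mp.
have [pk|kp] := ltnP (mdeg p.1) k; first by rewrite uk ?mul0r.
rewrite vl ?mulr0 // ltnNge; apply: contraL mkl => lp.
by rewrite -leqNgt -mp /mdeg size_normalize size_cat leq_add.
Qed.

Lemma order_ge_z i : order_ge 1 (z i : S).
Proof. by move=> m; rewrite /z; case: (m =P mvar c i) => [->|]. Qed.

Lemma order_ge_prod F w : (forall i, order_ge 1 (F i)) ->
  order_ge (size w) (\prod_(i <- w) F i).
Proof.
move=> F1; elim: w => // i w IHw; rewrite big_cons -[size _]add1n.
exact: order_geM.
Qed.

Lemma order_ge_word_der N w : order_ge (size w).-1 (word_der N w).
Proof.
elim: w => // i w IHw; apply: order_geD.
  rewrite -[_.-1]add0n; apply: order_geM => //; apply: order_ge_prod.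
  exact: order_ge_z.
case: w IHw => [|j w] IHw /=; first by [].
rewrite -[_.+1]add1n; apply: order_geM => //; exact: order_ge_z.
Qed.

Lemma subst_linear F : linear (subst F).
Proof.
move=> a u v; apply/funext => m.
rewrite -[RHS]/(a * subst F u m + subst F v m) /subst mulr_sumr -big_split.
by apply: eq_bigr => w _; rewrite /= mulrA -mulrDl.
Qed.

Lemma substD F : {morph subst F : u v / u + v}.
Proof. by move=> u v; have := subst_linear F 1 u v; rewrite !scale1r. Qed.

Lemma subst0 F : subst F 0 = 0.
Proof. by apply: (addIr (subst F 0)); rewrite -substD !add0r. Qed.

Lemma substZ F a u : subst F (a *: u) = a *: subst F u.
Proof. by have := subst_linear F a u 0; rewrite subst0 !addr0. Qed.

Lemma substN F u : subst F (- u) = - subst F u.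
Proof. by rewrite -scaleN1r substZ scaleN1r. Qed.

Lemma der_linear N : linear (der N).
Proof.
move=> a u v; apply/funext => m.
rewrite -[RHS]/(a * der N u m + der N v m) /der mulr_sumr -big_split.
by apply: eq_bigr => w _; rewrite /= mulrA -mulrDl.
Qed.

Lemma order_ge_subst F k u : order_ge k u -> order_ge k (subst F u).
Proof.
move=> uk m mk; rewrite /subst big_seq big1 // => w; rewrite mem_mons => wm.
by rewrite uk ?mul0r // (leq_ltn_trans wm).
Qed.

Lemma order_ge_der N k u : order_ge k.+1 u -> order_ge k (der N u).
Proof.
move=> uk m mk; rewrite /der big_seq big1 // => w; rewrite mem_mons => wm.
by rewrite uk ?mul0r // (leq_ltn_trans wm).
Qed.

Lemma subst_monomial F w : (forall i, order_ge 1 (F i)) ->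
  subst F (monomial w) = \prod_(i <- word w) F i.
Proof.
move=> F1; apply/funext => m; rewrite /subst /monomial.
have [wm|mw] := leqP (mdeg w) (mdeg m).
  rewrite (bigD1_seq w) ?mons_uniq ?mem_mons //= eqxx mul1r [X in _ + X]big1 ?addr0 // => x.
  by move=> /negPf ->; rewrite mul0r.
rewrite order_ge_prod // big_seq big1 // => x; rewrite mem_mons => xm.
by case: eqP xm => [->|_ _]; rewrite ?mul0r // leqNgt mw.
Qed.

Lemma der_monomial N w : der N (monomial w) = word_der N (word w).
Proof.
apply/funext => m; rewrite /der /monomial.
have [wm|mw] := leqP (mdeg w) (mdeg m).+1.
  rewrite (bigD1_seq w) ?mons_uniq ?mem_mons //= eqxx mul1r [X in _ + X]big1 ?addr0 // => x.
  by move=> /negPf ->; rewrite mul0r.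
rewrite order_ge_word_der; last by rewrite -ltnS prednK // (leq_trans _ mw).
rewrite big_seq big1 // => x; rewrite mem_mons => xm.
by case: eqP xm => [->|_ _]; rewrite ?mul0r // leqNgt mw.
Qed.

Lemma subst_z F i : (forall i, order_ge 1 (F i)) -> subst F (z i) = F i.
Proof. by move=> F1; rewrite [z i]/(monomial _) subst_monomial // big_seq1. Qed.

Lemma der_z N i : der N (z i) = N i.
Proof.
by rewrite [z i]/(monomial _) der_monomial /= big_nil mulr1 mulr0 addr0.
Qed.

Lemma derN N u : der (fun i => - N i) u = - der N u.
Proof.
have wN w : word_der (fun i => - N i) w = - word_der N w.
  by elim: w => [|i w /= ->]; rewrite /= ?oppr0 // opprD mulNr mulrN.
apply/funext => m; rewrite -[RHS]/(- der N u m) /der -sumrN.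
by apply: eq_bigr => w _; rewrite wN -mulrN.
Qed.

Lemma order_ge_subst_inv F u : order_ge 1 (subst F u) -> order_ge 1 u.
Proof.
move=> Fu m m1; rewrite -[RHS](Fu m m1) /subst.
have m0 : mdeg m = 0%N by case: (mdeg m) m1.
have nil w : mdeg w = 0%N -> w = mnil c n.
  by move=> w0; apply: val_inj; apply: size0nil.
rewrite (nil m m0) (bigD1_seq (mnil c n)) ?mons_uniq ?mem_mons //=.
rewrite big_nil -[(1 : S) _]/((mnil c n == mnil c n)%:R) eqxx mulr1 big_seq_cond big1 ?addr0 //.
by move=> w; rewrite mem_mons leqn0 => /andP[/eqP/nil ->]; rewrite eqxx.
Qed.

(** A strong form of z-adic continuity. The loss of one degree accommodates
    derivations, which may lower the order by one. *)
Definition continuous1 (P : S -> S) := forall k u, order_ge k.+1 u -> order_ge k (P u).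

(** At the monomial m, only the finitely many terms of u of degree at most
    deg m + 1 matter, and on this finite sum linearity suffices. This lemma
    reduces the identities between operators below to monomials. *)
Lemma zser_linear_ext P Q : linear P -> linear Q -> continuous1 P -> continuous1 Q ->
  (forall w, P (monomial w) = Q (monomial w)) -> P =1 Q.
Proof.
move=> linP linQ cP cQ PQ u; apply/funext => m.
pose LP := GRing.isLinear.Build R S S _ P linP.
pose fP : {linear S -> S} := HB.pack P LP.
pose LQ := GRing.isLinear.Build R S S _ Q linQ.
pose fQ : {linear S -> S} := HB.pack Q LQ.
pose t : S := \sum_(w <- mons c n (mdeg m).+1) u w *: monomial w.
have tE x : (mdeg x <= (mdeg m).+1)%N -> t x = u x.
  have termE w : (u w *: monomial w) x = u w * (x == w)%:R by [].
  move=> xm; rewrite /t zser_sumE (bigD1_seq x) ?mons_uniq ?mem_mons //=.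
  rewrite termE eqxx mulr1 big1 ?addr0 // => w /negPf wx.
  by rewrite termE eq_sym wx mulr0.
(* One degree more than deg m + 1: applying P or Q loses one. *)
have ut : order_ge (mdeg m).+2 (u - t).
  by move=> x xm; rewrite -[LHS]/(u x - t x) tE // subrr.
have PD : P u = P (u - t) + P t.
  by rewrite -[in LHS](subrK t u); apply: (raddfD fP).
have QD : Q u = Q (u - t) + Q t.
  by rewrite -[in LHS](subrK t u); apply: (raddfD fQ).
have PQt : P t = Q t.
  rewrite -[P t]/(fP t) -[Q t]/(fQ t) !linear_sum.
  by apply: eq_bigr => w _; rewrite !linearZ; congr (_ *: _); apply: PQ.
rewrite PD QD PQt -[LHS]/(P (u - t) m + Q t m) -[RHS]/(Q (u - t) m + Q t m).
by rewrite (cP _ _ ut) // (cQ _ _ ut).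
Qed.

Hypothesis mulRC : forall x y : R, x * y = y * x.

Lemma zser_scaleAr (a : R) u v : a *: (u * v) = u * (a *: v).
Proof.
apply/funext => m; rewrite -[LHS]/(a * (u * v) m) !zser_mulE mulr_sumr.
by apply: eq_bigr => p _; rewrite mulrA (mulRC a) -mulrA.
Qed.

Lemma zser_mulC u v : c = Commutative -> u * v = v * u.
Proof.
move=> cC; apply/funext => m; rewrite !zser_mulE.
have swapI : injective (fun p : mon c n * mon c n => (p.2, p.1)) by move=> [? ?] [? ?] [-> ->].
rewrite (perm_big [seq (p.2, p.1) | p <- splits m]).
  by rewrite big_map; apply: eq_bigr => p _; apply: mulRC.
apply: uniq_perm; rewrite ?map_inj_uniq ?splits_uniq // => -[a b].
rewrite -[(a, b) in RHS]/((fun p => (p.2, p.1)) (b, a)) mem_map // !mem_splits /=.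
suff -> : monM a b = monM b a by [].
apply: val_inj; rewrite /=; move: (word a) (word b) => s t.
rewrite /normalize cC.
apply/(perm_sortP (@ordle_total _) (@ordle_trans _) (@ordle_anti _)).
by rewrite perm_catC.
Qed.

(** Normalizing a word permutes its letters, and does so only when the variables,
    hence the series, commute. *)
Lemma prod_normalize F w : \prod_(i <- normalize c w) F i = \prod_(i <- w) F i.
Proof.
have [-> //|[cC]] : normalize c w = w \/
    c = Commutative /\ perm_eq w (normalize c w).
  rewrite /normalize; case: (c); last by left.
  by right; rewrite perm_sym perm_sort.
move: (normalize c w) => w' ww'.
apply: (@catCA_perm_ind _ (fun x => \prod_(i <- x) F i = \prod_(i <- w) F i) _ _ _ ww') => //.
by move=> s1 s2 s3; rewrite !big_cat /= !mulrA [X in X * _](zser_mulC _ _ cC).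
Qed.

(** Reduction to two monomials, in u first and then in v; the latter needs the
    coefficients to be central. *)
Lemma substM F u v : (forall i, order_ge 1 (F i)) ->
  subst F (u * v) = subst F u * subst F v.
Proof.
move=> F1; move: u.
have linM (P : S -> S) x : linear P -> linear (fun u => P u * x).
  by move=> linP a u u'; rewrite linP mulrDl scalerAl.
have linM' (P : S -> S) x : linear P -> linear (fun u => x * P u).
  by move=> linP a u u'; rewrite linP mulrDr zser_scaleAr.
have linI : linear (@idfun S) by [].
have linC (P Q : S -> S) : linear P -> linear Q -> linear (P \o Q).
  by move=> linP linQ a u u'; rewrite /= linQ linP.
have linS := subst_linear F.
apply: zser_linear_ext.
- exact: (linC _ _ linS (linM _ v linI)).
- exact: linM.
- move=> k u uk; apply: order_ge_subst; apply: order_geW (leqnSn _) _.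
  by rewrite -[k.+1]addn0; apply: order_geM.
- move=> k u uk; apply: order_geW (leqnSn _) _.
  by rewrite -[k.+1]addn0; apply: order_geM => //; apply: order_ge_subst.
move=> w; move: v; apply: zser_linear_ext.
- exact: (linC _ _ linS (linM' _ _ linI)).
- exact: linM'.
- move=> k u uk; apply: order_ge_subst; apply: order_geW (leqnSn _) _.
  by rewrite -[k.+1]add0n; apply: order_geM.
- move=> k u uk; apply: order_geW (leqnSn _) _.
  by rewrite -[k.+1]add0n; apply: order_geM => //; apply: order_ge_subst.
move=> w'; rewrite monomialM !subst_monomial //= prod_normalize.
exact: big_cat.
Qed.

Lemma subst_prod F N w : (forall i, order_ge 1 (F i)) ->
  subst F (\prod_(i <- w) N i) = \prod_(i <- w) subst F (N i).
Proof.
move=> F1; elim: w => [|i w IHw]; last by rewrite !big_cons substM // IHw.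
rewrite !big_nil -[1]/(monomial (mnil c n)) subst_monomial //; exact: big_nil.
Qed.

(** The composite and the identity are continuous ring morphisms that agree on the
    variables. *)
Lemma substK F G : (forall i, order_ge 1 (F i)) -> (forall i, order_ge 1 (G i)) ->
  (forall i, subst F (G i) = z i) -> cancel (subst G) (subst F).
Proof.
move=> F1 G1 FG; apply: zser_linear_ext => //.
- by move=> a u v; rewrite !subst_linear.
- move=> k u uk; apply: order_geW (leqnSn _) _.
  by do 2! apply: order_ge_subst.
- by move=> k u; apply: order_geW.
move=> w; rewrite subst_monomial // subst_prod // -prod_word.
by apply: eq_bigr => i _; rewrite FG.
Qed.

End PowerSeries.

Arguments monomial {c n R} w.

(** * The derivative in t and the chain rule *)
Section TimeDerivative.
Variables (c : kind) (n : nat) (K : comAlgType rat).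
Local Notation A := (zser c n K).
Local Notation At := (zser c n (tser K)).
Implicit Types (u : At) (F N : 'I_n -> At).

Lemma tser_mulC (x y : tser K) : x * y = y * x.
Proof.
apply/funext => k; rewrite !tser_mulE (reindex_inj rev_ord_inj).
by apply: eq_bigr => i _; rewrite /= subSS subKn -1?ltnS // mulrC.
Qed.

Definition dts (x : tser K) : tser K := fun k => x k.+1 *+ k.+1.

Lemma dtsD : {morph dts : x y / x + y}.
Proof. by move=> x y; apply/funext => k; apply: mulrnDl. Qed.

Lemma dtsM x y : dts (x * y) = dts x * y + x * dts y.
Proof.
apply/funext => k; rewrite -[RHS]/((dts x * y) k + (x * dts y) k) /dts !tser_mulE.
pose T i := x i * y (k.+1 - i)%N.
(* Leibniz: k.+1 = i + (k.+1 - i) in each term of the convolution. *)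
transitivity (\sum_(i < k.+2) T i *+ i + \sum_(i < k.+2) T i *+ (k.+1 - i)).
  rewrite -big_split -sumrMnl; apply: eq_bigr => i _.
  by rewrite /= -mulrnDr subnKC // -ltnS.
rewrite big_ord_recl mulr0n add0r [X in _ + X]big_ord_recr /= subnn mulr0n addr0.
congr (_ + _); apply: eq_bigr => i _.
  by rewrite /bump /T /= add1n subSS mulrnAl.
by rewrite /T subSn -1?ltnS // mulrnAr.
Qed.

Lemma dtD : {morph @dt c n K : u v / u + v}.
Proof. by move=> u v; apply/funext => m; apply: dtsD. Qed.

Lemma dtM u v : dt (u * v) = dt u * v + u * dt v.
Proof.
apply/funext => m; rewrite -[LHS]/(dts ((u * v) m)).
rewrite -[RHS]/((dt u * v) m + (u * dt v) m) !zser_mulE.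
have dts0 : dts 0 = 0 by apply/funext => k; apply: mul0rn.
rewrite (big_morph _ dtsD dts0) -big_split; apply: eq_bigr => p _.
exact: dtsM.
Qed.

Lemma dtZ a u : dt (a *: u) = dts a *: u + a *: dt u.
Proof. by apply/funext => m; apply: dtsM. Qed.

Lemma dt_monomial w : dt (monomial w : At) = 0.
Proof.
apply/funext => m; apply/funext => k; rewrite /dt /monomial.
by case: (m == w); apply: mul0rn.
Qed.

Lemma order_ge_dt k u : order_ge k u -> order_ge k (dt u).
Proof. by move=> uk m mk; apply/funext => j; rewrite /dt uk //; apply: mul0rn. Qed.

(** The chain rule. Neither u(F)' nor u'(F) is linear over K[[t]] in u, but their
    difference is; on a monomial it is the Leibniz rule for a product of F_i. *)
Lemma dt_subst F N u : (forall i, order_ge 1 (F i)) ->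
  (forall i, subst F (N i) = dt (F i)) ->
  dt (subst F u) = subst F (dt u) + subst F (der N u).
Proof.
move=> F1 FN; rewrite addrC; apply/eqP; rewrite -subr_eq; apply/eqP; move: u.
have linF := @subst_linear c n _ F.
apply: zser_linear_ext.
- move=> a u v; rewrite linF !dtD !dtZ !substD !substZ scalerBr.
  by rewrite -[X in X - _]addrA -[X in _ - X]addrA opprD addrACA subrr add0r opprD addrACA.
- by move=> a u v; rewrite der_linear linF.
- move=> k u uk; apply: (order_geW (leqnSn k)); apply: order_geD.
    by apply/order_ge_dt/order_ge_subst.
  move=> m mk; rewrite -[LHS]/(- subst F (dt u) m) (order_ge_subst F (order_ge_dt uk)) //.
  exact: oppr0.
- by move=> k u uk; apply/order_ge_subst/order_ge_der.
move=> w; rewrite dt_monomial der_monomial subst_monomial //.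
rewrite subst0 subr0; elim: (word w) => [|i w' IHw] /=.
  rewrite big_nil subst0.
  exact: (dt_monomial (mnil c n)).
rewrite big_cons dtM IHw substD !(substM tser_mulC) // FN subst_z // (subst_prod tser_mulC) //.
by congr (_ * _ + _); apply: eq_bigr => j _; rewrite subst_z.
Qed.

Definition tconst (v : A) : At := fun m k => if k is 0 then v m else 0.

Lemma tcoef_tconst k v : tcoef k (tconst v) = if k is 0 then v else 0.
Proof. by case: k. Qed.

Lemma dt_tconst v : dt (tconst v) = 0.
Proof. by apply/funext => m; apply/funext => k; apply: mul0rn. Qed.

Lemma tcoef_dt k u : tcoef k (dt u) = tcoef k.+1 u *+ k.+1.
Proof.
apply/funext => m.
have MnE (v : A) j : (v *+ j) m = v m *+ j.
  by elim: j => // j IHj; rewrite !mulrS -IHj.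
by rewrite MnE.
Qed.

Lemma z_tconst i : z i = tconst (z i).
Proof.
apply/funext => m; apply/funext => k; rewrite /z /tconst.
by case: (m == _); case: k.
Qed.

Lemma tcoefD k u v : tcoef k (u + v) = tcoef k u + tcoef k v.
Proof. by []. Qed.

Lemma tcoef_eqP u v : (forall k, tcoef k u = tcoef k v) -> u = v.
Proof.
by move=> e; apply/funext => m; apply/funext => k; have /(congr1 (@^~ m)) := e k.
Qed.

Lemma tcoef_act k (P : nat -> A -> A) u :
  tcoef k (act P u) = \sum_(i < k.+1) P i (tcoef (k - i) u).
Proof. by []. Qed.

Lemma tcoef_tser_scale k (a : K) u : tcoef k ((a%:A : tser K) *: u) = a *: tcoef k u.
Proof.
apply/funext => m; rewrite -[LHS]/((a *: 1 * u m : tser K) k) -scalerAl mul1r.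
by [].
Qed.

(** The coefficients of a series of operators can be read off its action: applied
    to a series v constant in t, the coefficient of t^k is P_k v plus values
    P_i 0 for i < k, and these vanish inductively. So the P_k inherit linearity
    from the action. *)
Lemma act_linear (P : nat -> A -> A) (Q : At -> At) :
  linear Q -> (forall u, act P u = Q u) ->
  (forall k, linear (P k)) /\ (forall k v, P k v = tcoef k (Q (tconst v))).
Proof.
move=> linQ PQ.
have Q0 : Q 0 = 0 by have := linQ (-1) 0 0; rewrite scaler0 addr0 scaleN1r addNr.
have PE m : (forall i, (i < m)%N -> P i 0 = 0) ->
    forall v, P m v = tcoef m (Q (tconst v)).
  move=> P0 v; rewrite -PQ tcoef_act big_ord_recr big1 /= => [|i _].
    by rewrite add0r subnn.
  have : (0 < m - i)%N by rewrite subn_gt0.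
  by rewrite tcoef_tconst; case: (m - i)%N => // j _; apply: P0.
have P0 k : P k 0 = 0.
  have [m] := ubnP k; elim: m k => // m IHm k km.
  rewrite (PE k) => [|i ik]; last by apply: IHm; apply: leq_trans ik _.
  suff -> : tconst 0 = 0 by rewrite Q0.
  by apply/funext => x; apply/funext => -[].
have {}PE k v : P k v = tcoef k (Q (tconst v)) by apply: PE => i _; apply: P0.
split=> // k a u v; rewrite !PE -tcoef_tser_scale -tcoefD -linQ; congr (tcoef k (Q _)).
apply/funext => x; rewrite -[RHS]/((a *: 1 * tconst u x : tser K) + _) -scalerAl mul1r.
by apply/funext => -[|j] //; rewrite -[RHS]/(a * 0 + 0) mulr0 addr0.
Qed.

End TimeDerivative.

(** * The Q-algebra of linear endomorphisms *)
Section LinearEndomorphisms.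
Variables (K : comAlgType rat) (V : lalgType K).

(** Over a rat-algebra K and a nonzero module (here an algebra V), the linear
    endomorphisms form a nontrivial Q-algebra, so that the results on E[[t]] apply
    to series of operators. *)
Record lend := Lend { lend_fun :> V -> V; lend_linear : linear lend_fun }.
Implicit Types f g h : lend.

HB.instance Definition _ := gen_eqMixin lend.
HB.instance Definition _ := gen_choiceMixin lend.

Lemma lend_ext f g : f =1 g -> f = g.
Proof.
case: f g => [f lf] [g lg] /= /funext fg; case: g / fg lg => lg.
by congr Lend; apply: Prop_irrelevance.
Qed.

Lemma lendD f : {morph f : u v / u + v}.
Proof. by move=> u v; have := lend_linear f 1 u v; rewrite !scale1r. Qed.

Lemma lend0 f : f 0 = 0.
Proof. by apply: (addIr (f 0)); rewrite -lendD !add0r. Qed.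

Lemma lendZ f a v : f (a *: v) = a *: f v.
Proof. by have := lend_linear f a v 0; rewrite lend0 !addr0. Qed.

Fact zero_linear : linear (fun _ : V => 0 : V).
Proof. by move=> a u v; rewrite scaler0 addr0. Qed.
Fact opp_linear f : linear (fun v => - f v).
Proof. by move=> a u v; rewrite lendD lendZ opprD scalerN. Qed.
Fact add_linear f g : linear (fun v => f v + g v).
Proof. by move=> a u v; rewrite !lendD !lendZ scalerDr addrACA. Qed.
Fact id_linear : linear (fun v : V => v).
Proof. by []. Qed.
Fact comp_linear f g : linear (fun v => f (g v)).
Proof. by move=> a u v; rewrite !lendD !lendZ. Qed.
Fact scale_linear (q : rat) f : linear (fun v => (q%:A : K) *: f v).
Proof. by move=> a u v; rewrite lendD lendZ scalerDr !scalerA mulrC. Qed.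

Fact lend_addA : associative (fun f g => Lend (add_linear f g)).
Proof. by move=> f g h; apply: lend_ext => v; apply: addrA. Qed.
Fact lend_addC : commutative (fun f g => Lend (add_linear f g)).
Proof. by move=> f g; apply: lend_ext => v; apply: addrC. Qed.
Fact lend_add0 : left_id (Lend zero_linear) (fun f g => Lend (add_linear f g)).
Proof. by move=> f; apply: lend_ext => v; apply: add0r. Qed.
Fact lend_addN : left_inverse (Lend zero_linear) (fun f => Lend (opp_linear f))
  (fun f g => Lend (add_linear f g)).
Proof. by move=> f; apply: lend_ext => v; apply: addNr. Qed.

HB.instance Definition _ := GRing.isZmodule.Build lend
  lend_addA lend_addC lend_add0 lend_addN.

Fact lend_mulA : associative (fun f g => Lend (comp_linear f g)).
Proof. by move=> f g h; apply: lend_ext. Qed.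
Fact lend_mul1 : left_id (Lend id_linear) (fun f g => Lend (comp_linear f g)).
Proof. by move=> f; apply: lend_ext. Qed.
Fact lend_mulr1 : right_id (Lend id_linear) (fun f g => Lend (comp_linear f g)).
Proof. by move=> f; apply: lend_ext. Qed.
Fact lend_mulDl : left_distributive (fun f g => Lend (comp_linear f g)) +%R.
Proof. by move=> f g h; apply: lend_ext. Qed.
Fact lend_mulDr : right_distributive (fun f g => Lend (comp_linear f g)) +%R.
Proof. by move=> f g h; apply: lend_ext => v; apply: lendD. Qed.
Fact lend1_neq0 : Lend id_linear != 0.
Proof. by apply/eqP => /(congr1 (fun f : lend => f 1)) /eqP; rewrite oner_eq0. Qed.

HB.instance Definition _ := GRing.Zmodule_isNzRing.Build lend
  lend_mulA lend_mul1 lend_mulr1 lend_mulDl lend_mulDr lend1_neq0.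

Definition lend_scale (q : rat) f := Lend (scale_linear q f).

Fact lend_scaleA p q f : lend_scale p (lend_scale q f) = lend_scale (p * q) f.
Proof.
by apply: lend_ext => v; rewrite /= scalerA -scalerAl mul1r scalerA.
Qed.
Fact lend_scale1 : left_id 1 lend_scale.
Proof. by move=> f; apply: lend_ext => v; rewrite /= !scale1r. Qed.
Fact lend_scaleDr : right_distributive lend_scale +%R.
Proof. by move=> q f g; apply: lend_ext => v; apply: scalerDr. Qed.
Fact lend_scaleDl f : {morph lend_scale^~ f : p q / p + q}.
Proof. by move=> p q; apply: lend_ext => v; rewrite /= scalerDl; apply: scalerDl. Qed.

HB.instance Definition _ := GRing.Zmodule_isLmodule.Build rat lend
  lend_scaleA lend_scale1 lend_scaleDr lend_scaleDl.

Fact lend_scaleAl (q : rat) f g : q *: (f * g) = q *: f * g.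
Proof. exact: lend_ext. Qed.
HB.instance Definition _ := GRing.Lmodule_isLalgebra.Build rat lend lend_scaleAl.

Fact lend_scaleAr (q : rat) f g : q *: (f * g) = f * (q *: g).
Proof. by apply: lend_ext => v; rewrite -[RHS]/(f (_ *: g v)) lendZ. Qed.
HB.instance Definition _ := GRing.Lalgebra_isAlgebra.Build rat lend lend_scaleAr.

Lemma lend_sumE (I : Type) (r : seq I) (P : pred I) (F : I -> lend) v :
  (\sum_(i <- r | P i) F i) v = \sum_(i <- r | P i) F i v.
Proof. exact: (big_morph (fun f : lend => f v)). Qed.

(** A total conversion, so that sequences of functions can be turned into sequences
    of endomorphisms without carrying linearity proofs. *)
Definition lend_of (P : V -> V) : lend :=
  if pselect (linear P) is left linP then Lend linP else 0.

Lemma lend_ofE (P : V -> V) : linear P -> lend_of P =1 P.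
Proof. by move=> linP v; rewrite /lend_of; case: pselect. Qed.

End LinearEndomorphisms.

(** * Series of operators *)
Section Operators.
Variables (c : kind) (n : nat) (K : comAlgType rat).
Local Notation A := (zser c n K).
Local Notation At := (zser c n (tser K)).
Local Notation E := (lend A).
Implicit Types (u : At) (v : A) (P Q : nat -> A -> A).

Definition tlend P : tser E := fun k => lend_of (P k).

Lemma tlendE P k v : linear (P k) -> tlend P k v = P k v.
Proof. by move=> linP; apply: lend_ofE. Qed.

Lemma tlend_mulE (x y : tser E) k v :
  (x * y) k v = \sum_(i < k.+1) x i (y (k - i)%N v).
Proof. by rewrite tser_mulE lend_sumE. Qed.

Lemma tlend_expE P k j v : (forall k, linear (P k)) ->
  (tlend P ^+ j) k v = tcoef k (iter j (act P) (tconst v)).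
Proof.
move=> linP; elim: j k => [|j IHj] k.
  by rewrite expr0 tcoef_tconst; case: k.
rewrite exprS tlend_mulE /= tcoef_act; apply: eq_bigr => i _.
by rewrite IHj tlendE.
Qed.

Lemma tlend_texp P k v : (forall k, linear (P k)) ->
  texp (tlend P) k v = tcoef k (act_exp P (tconst v)).
Proof.
move=> linP; rewrite lend_sumE; apply: eq_bigr => j _.
by rewrite -[LHS]/(_ *: (tlend P ^+ j) k v) tlend_expE.
Qed.

Lemma opow_prod P I v : (forall k, (0 < k)%N -> linear (P k)) -> all (leq 1) I ->
  opow P I v = (\prod_(i <- I) tlend P i) v.
Proof.
move=> linP; rewrite /opow; elim: I => [|i I IHI] /=; first by rewrite !big_nil.
case/andP=> i0 I1; rewrite !big_cons /= IHI //.
by rewrite -[RHS]/(tlend P i (_ v)) tlendE //; apply: linP.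
Qed.

Lemma sum_prod_opow P (q : seq nat -> rat) k v : (forall k, (0 < k)%N -> linear (P k)) ->
  (\sum_(I <- compositions k) q I *: \prod_(i <- I) tlend P i) v =
  \sum_(I <- compositions k) (q I)%:A *: opow P I v.
Proof.
move=> linP; rewrite lend_sumE big_seq [RHS]big_seq; apply: eq_bigr => I.
by case/compositionsP=> _ I1 _; rewrite opow_prod.
Qed.

Lemma tcoef_csum (q : seq nat -> A) k :
  tcoef k (csum q) = \sum_(J <- compositions k) q J.
Proof. by []. Qed.

Lemma opow_sign P Q I v : (forall k, linear (Q k)) ->
  (forall k v, Q k v = (-1) ^+ k *: P k v) ->
  opow Q I v = (-1) ^+ sumn I *: opow P I v.
Proof.
move=> linQ QP; rewrite /opow; elim: I => [|i I IHI] /=.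
  by rewrite !big_nil scale1r.
have QZ b w : Q i (b *: w) = b *: Q i w by rewrite -!(lend_ofE (linQ i)) lendZ.
rewrite !big_cons /= IHI QZ QP scalerA.
by rewrite -exprD addnC.
Qed.

Lemma in_alg_sign k : ((-1) ^+ k)%:A = (-1) ^+ k :> K.
Proof. by rewrite -[LHS]/(GRing.in_alg K _) rmorphXn rmorphN1. Qed.

End Operators.

(** The two shapes of the coefficient in the last formulas, [W] being the product
    of block weights in the form of [pi_u2]; it covers the reversed weights too. *)
Lemma splitting_weight (w : seq nat -> nat) (W : seq nat -> seq nat -> nat) I :
  I != [::] -> all (leq 1) I ->
  (forall B, block_seq B -> B != [::] ->
     W (flatten B) (map sumn B) = (\prod_(b <- B) w b)%N) ->
  \sum_(B <- splittings I) (-1) ^+ size B / (size B)%:R * \prod_(b <- B) (w b)%:R^-1 =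
  \sum_(J <- compositions (sumn I) | refines I J)
     (-1) ^+ size J / ((W I J)%:R * (size J)%:R) :> rat.
Proof.
move=> I0 I1 wW; rewrite sum_refines_splittings // big_seq [RHS]big_seq.
apply: eq_bigr => B; rewrite mem_splittings // => /andP[Bb /eqP BI].
rewrite size_map -[I in W I _]BI wW //; last by case: B BI I0 {Bb} => // <-.
by rewrite natr_prod prodfV invfM mulrA mulrAC.
Qed.

(** * The D-Log formulas *)

Theorem proposition5p1 (K : comAlgType rat) (c : kind) (n alpha : nat)
    (H M a : 'I_n -> zser c n (tser K))
    (lambda s d psi xi : nat -> zser c n K -> zser c n K)
    (F := fun i => z i - H i) (G := fun i => z i + M i)
    (alpha_ge1 : (1 <= alpha)%N)
    (* F_t is in A_t^[alpha]<<z>> and G_t is its inverse *)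
    (F_aut : is_automorphism F)
    (H_order : forall i, order_ge alpha (H i))
    (H_t0 : forall i, tcoef 0 (H i) = 0)
    (FG : forall i, subst F (G i) = z i) (GF : forall i, subst G (F i) = z i)
    (* f(t), with coefficients lambda_m *)
    (lambda_D : forall m, Dalg alpha (lambda m))
    (lambda_0 : lambda 0%N = id)
    (lambda_act : forall u,
      act (fun m v => (-1) ^+ m *: lambda m v) u = subst F u)
    (* g(t), with coefficients s_m *)
    (s_D : forall m, Dalg alpha (s m))
    (s_act : forall u, act s u = subst G u)
    (* d(t), with coefficients d_m = phi_m / m *)
    (d_D : forall m, Dalg alpha (d m))
    (d_0 : forall v, d 0%N v = 0)
    (d_act : forall u, act_exp d u = subst G u)
    (* h(t) and m(t), with coefficients psi_(m+1) and xi_(m+1) at t^m *)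
    (psi_act : forall u,
      act (fun m => psi m.+1) u = der (fun i => subst F (dt (M i))) u)
    (xi_act : forall u,
      act (fun m => xi m.+1) u = der (fun i => subst G (dt (H i))) u)
    (* the D-Log *)
    (a_t0 : forall i, tcoef 0 (a i) = 0)
    (a_log : forall u, act d u = - der a u) :
  forall i : 'I_n,
  [/\ a i = csum (fun I =>
        ((-1) ^ ((size I)%:Z - (sumn I)%:Z + 1) / (size I)%:R)%:A
          *: opow lambda I (z i)),
      a i = csum (fun I =>
        ((-1) ^+ size I / (size I)%:R)%:A *: opow s I (z i)),
      a i = csum (fun I =>
        (\sum_(J <- compositions (sumn I) | refines I J)
           (-1) ^+ size J / ((pi_u2 I J)%:R * (size J)%:R))%:A
          *: opow psi I (z i)) &
      a i = csum (fun I =>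
        (\sum_(J <- compositions (sumn I) | refines I J)
           (-1) ^+ size J / ((pi_u2 (rev I) (rev J))%:R * (size J)%:R))%:A
          *: opow xi I (z i))].
Proof.
have [F1 bijF] := F_aut.
have mulC := @tser_mulC K.
(* The constant term of G_i(F) = z_i is that of G_i. *)
have G1 i : order_ge 1 (G i).
  by apply: (order_ge_subst_inv (F := F)); rewrite FG; apply: order_ge_z.
have FGK := substK mulC F1 G1 FG.
have GFK := substK mulC G1 F1 GF.
have linF := @subst_linear c n _ F; have linG := @subst_linear c n _ G.
have [linf fE] := act_linear linF lambda_act.
have [lins sE] := act_linear linG s_act.
have [lind dE] : (forall k, linear (d k)) /\
    (forall k v, d k v = tcoef k (- der a (tconst v))).
  apply: act_linear a_log => x u v; rewrite der_linear opprD.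
  by rewrite scalerN.
have [linp pE] := act_linear (@der_linear c n _ _) psi_act.
have [linx xE] := act_linear (@der_linear c n _ _) xi_act.
pose f m v := (-1) ^+ m *: lambda m v.
pose D := tlend d; pose S := tlend s; pose L := tlend f.
have DE k v : D k v = d k v by exact: (tlendE v (lind k)).
have SE k v : S k v = s k v by exact: (tlendE v (lins k)).
have LE k v : L k v = f k v by exact: (tlendE v (linf k)).
have D0 : D 0%N = 0 by apply: lend_ext => v; rewrite DE d_0.
have S_exp : S = texp D.
  by apply/funext => k; apply: lend_ext => v; rewrite tlend_texp // d_act SE sE.
(* f(-t) g(t) = 1, as u(G) evaluated at F gives back u. *)
have LS : L * S = 1.
  apply/funext => k; apply: lend_ext => v; rewrite tlend_mulE.
  transitivity (tcoef k (act f (act s (tconst v)))).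
    by apply: eq_bigr => i _; rewrite LE SE s_act sE.
  by rewrite lambda_act s_act FGK tcoef_tconst; case: k.
have L_exp : L = texp (- D) by apply: texp_left_inv; rewrite // -S_exp.
have S0 : S 0%N = 1.
  by rewrite S_exp /texp big_ord1 fact0 invr1 scale1r.
(* [a d/dz] sends z_i to a_i. *)
have aE i k : tcoef k (a i) = (- D k) (z i).
  rewrite -[RHS]/(- D k (z i)) tlendE // dE -z_tconst der_z.
  by rewrite -[tcoef k (- _)]/(- tcoef k (a i)) opprK.
have DS k : - D k = \sum_(J <- compositions k)
    ((-1) ^+ size J / (size J)%:R) *: \prod_(j <- J) S j.
  rewrite (log_texp k D0) -sumrN -S_exp; apply: eq_bigr => J _.
  by rewrite scaleNr opprK.
have linpsi k : (0 < k)%N -> linear (psi k) by case: k => // k _; apply: linp.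
have linxi k : (0 < k)%N -> linear (xi k) by case: k => // k _; apply: linx.
have dtS k v : (S k.+1 *+ k.+1) v = tcoef k (dt (subst G (tconst v))).
  have MnE (g : lend (zser c n K)) j : (g *+ j) v = g v *+ j.
    by elim: j => // j IHj; rewrite !mulrS -IHj.
  by rewrite MnE SE sE tcoef_dt.
have dtz j : dt (z j) = 0 :> zser c n (tser K) by apply: dt_monomial.
(* For v constant in t, the derivative of v(G) is ([N d/dz] v)(G) for any N with
   N(G) = G', and N = M'(F) qualifies. So g' = g h. *)
have S_psi : forall k, S k =
    \sum_(I <- comps k) (pi_u I)%:R^-1 *: \prod_(j <- I) tlend psi j.
  apply: pi_u_rec_right S0 _ => k; apply: lend_ext => v; rewrite dtS.
  rewrite (dt_subst _ (N := fun j => subst F (dt (M j))) G1) => [|j]; last first.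
    by rewrite GFK /G dtD dtz add0r.
  rewrite dt_tconst subst0 add0r -psi_act -s_act tcoef_act lend_sumE.
  apply: eq_bigr => j _; rewrite -[RHS]/(S j (tlend psi _ v)) SE tlendE ?linpsi //.
  by rewrite psi_act pE.
(* Likewise u(F)' = u'(F) - (m u)(F). For u = v(G) with v constant in t the left side is
   v' = 0, and substituting G gives v(G)' = m v(G). So g' = m g. *)
have S_xi : forall k, S k =
    \sum_(I <- comps k) (pi_u (rev I))%:R^-1 *: \prod_(j <- I) tlend xi j.
  apply: pi_u_rec_left S0 _ => k; apply: lend_ext => v; rewrite dtS.
  have dtF u : dt (subst F u) = subst F (dt u) - subst F (act (fun m => xi m.+1) u).
    rewrite xi_act (dt_subst _ (N := fun j => - subst G (dt (H j))) F1) => [|j].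
      by rewrite derN substN.
    rewrite substN FGK; apply/eqP; rewrite eq_sym -subr_eq0 opprK -dtD subrK.
    by rewrite dtz.
  have /eqP := dtF (subst G (tconst v)).
  rewrite FGK dt_tconst eq_sym subr_eq0 => /eqP/(can_inj GFK) ->.
  rewrite -s_act tcoef_act lend_sumE; apply: eq_bigr => j _.
  rewrite -[RHS]/(tlend xi _ (S _ v)) tlendE ?linxi // SE; congr (xi _ _).
  by rewrite s_act sE.
have S_pos (p : nat -> lend (zser c n K)) (w : seq nat -> nat) :
    (forall k, S k = \sum_(I <- comps k) (w I)%:R^-1 *: \prod_(j <- I) p j) ->
    forall k, (0 < k)%N ->
    S k = \sum_(I <- compositions k) (w I)%:R^-1 *: \prod_(j <- I) p j.
  by move=> Sp [].
(* The last two formulas: substitute an expansion of g over compositions into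
   the formula in terms of g. *)
have a_series P (w : seq nat -> nat) (W : seq nat -> seq nat -> nat) i k :
    (forall k, (0 < k)%N -> linear (P k)) ->
    (forall k, S k = \sum_(I <- comps k) (w I)%:R^-1 *: \prod_(j <- I) tlend P j) ->
    (forall B, block_seq B -> B != [::] ->
     W (flatten B) (map sumn B) = (\prod_(b <- B) w b)%N) ->
    tcoef k (a i) = \sum_(I <- compositions k)
      (\sum_(J <- compositions (sumn I) | refines I J)
        (-1) ^+ size J / ((W I J)%:R * (size J)%:R))%:A *: opow P I (z i).
  move=> linP SP wW; rewrite aE DS.
  rewrite (sum_prod_refine (S_pos _ _ SP) (fun l => (-1) ^+ l / l%:R)).
  rewrite sum_prod_opow // big_seq [RHS]big_seq; apply: eq_bigr => I.
  by case/compositionsP=> I0 I1 _; rewrite (splitting_weight I0 I1 wW).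
move=> i; split; apply: tcoef_eqP => k.
(* f(-t) = exp (-d(t)), so that a is the logarithm of f(-t) applied to z. *)
- rewrite aE -[- D k]/((- D) k) log_texp -?L_exp; last first.
    by rewrite -[LHS]/(- D 0%N) D0 oppr0.
  rewrite sum_prod_opow => [|j _]; last exact: linf.
  rewrite tcoef_csum big_seq [RHS]big_seq.
  apply: eq_bigr => J /compositionsP[J0 _ _]; rewrite (opow_sign (P := lambda)) // scalerA.
  congr (_ *: _); rewrite -in_alg_sign -scalerAl mul1r scalerA; congr (_%:A).
  rewrite !expfzDr ?oppr_eq0 ?oner_eq0 // expr1z -exprnN invr_sign -exprnP.
  by rewrite mulrN1 !mulNr mulrAC.
- by rewrite aE DS sum_prod_opow.
- exact: a_series linpsi S_psi pi_u2_blocks.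
- exact: a_series linxi S_xi pi_u2_blocks_rev.
Qed.
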